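(* Let $g$ be a $\Sigma_1$-definable function such that for every $k \in \omega$ there exists $n \in \omega$ such that $\mathrm{RCA}_0^* \vdash \forall x \ge n\, (g(x) \ge x^k)$. Then neither $\mathrm{WKL}_0^* + \mathrm{CAC}$ nor $\mathrm{WKL}_0^* + \mathrm{ADS}$ proves that $\mathrm{I}^0_1$ is closed under $g$.
   Context: $\mathrm{RCA}_0^*$ is $\mathrm{RCA}_0$ with $\Sigma^0_1$-induction replaced by $\Delta^0_0$-induction plus the axiom $\exp$; $\mathrm{WKL}_0^*$ is $\mathrm{RCA}_0^*$ plus Weak König's Lemma. A set is unbounded if it contains elements above every number. $\mathrm{CAC}$: every partial order $(\mathbb{N},\preceq)$ has an unbounded chain or antichain. $\mathrm{ADS}$: every linear order $(\mathbb{N},\preceq)$ has an unbounded $S$ such that either for all $x,y\in S$, $x\le y\iff x\preceq y$, or for all $x,y\in S$, $x\le y\iff x\succeq y$. $\mathrm{I}^0_1$ denotes the definable cut consisting of those numbers $x$ such that every unbounded set $S\subseteq\mathbb{N}$ contains a finite subset of cardinality $x$; ''$\mathrm{I}^0_1$ is closed under $g$'' means $\forall x\,(x\in\mathrm{I}^0_1\to g(x)\in\mathrm{I}^0_1)$. *)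

(* Defs.v *)
(* Stdlib world. *)
From Stdlib Require Import List.
Import ListNotations.

(** * The language of second-order arithmetic

    De Bruijn syntax with two independent index spaces, one for number
    variables and one for set variables: [All]/[Ex] bind number variable 0,
    [AllS]/[ExS] bind set variable 0.  Sets have no terms besides variables. *)

Inductive term : Type :=
| Var (n : nat)
| Zero
| One
| Add (s t : term)
| Mul (s t : term).

Inductive form : Type :=
| Bot
| Eq (s t : term)
| Lt (s t : term)
| Mem (t : term) (X : nat)
| Imp (A B : form)
| And (A B : form)
| Or (A B : form)
| All (A : form)
| Ex (A : form)
| AllS (A : form)
| ExS (A : form).

Definition Neg (A : form) : form := Imp A Bot.
Definition Iff (A B : form) : form := And (Imp A B) (Imp B A).
Definition Le (s t : term) : form := Or (Lt s t) (Eq s t).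

Declare Scope form_scope.
Delimit Scope form_scope with form.
Notation "$ n" := (Var n) (at level 1, format "$ n") : form_scope.
Notation "s ⊕ t" := (Add s t) (at level 50, left associativity) : form_scope.
Notation "s ⊗ t" := (Mul s t) (at level 40, left associativity) : form_scope.
Notation "s ≐ t" := (Eq s t) (at level 70, no associativity) : form_scope.
Notation "s ≺ t" := (Lt s t) (at level 70, no associativity) : form_scope.
Notation "s ≼ t" := (Le s t) (at level 70, no associativity) : form_scope.
Notation "t ∈ X" := (Mem t X) (at level 70, no associativity) : form_scope.
Notation "¬ A" := (Neg A) (at level 75, right associativity) : form_scope.
Notation "A ∧ B" := (And A B) (at level 80, right associativity) : form_scope.
Notation "A ∨ B" := (Or A B) (at level 85, right associativity) : form_scope.
Notation "A ⇒ B" := (Imp A B) (at level 90, right associativity) : form_scope.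
Notation "A ⇔ B" := (Iff A B) (at level 95, no associativity) : form_scope.
Local Open Scope form_scope.

(** ** Substitution *)

Fixpoint tsubst (sg : nat -> term) (t : term) : term :=
  match t with
  | Var n => sg n
  | Zero => Zero
  | One => One
  | Add s u => Add (tsubst sg s) (tsubst sg u)
  | Mul s u => Mul (tsubst sg s) (tsubst sg u)
  end.

Definition tlift (k : nat) (t : term) : term := tsubst (fun n => Var (k + n)) t.

Definition scons {A : Type} (a : A) (f : nat -> A) (n : nat) : A :=
  match n with 0 => a | S m => f m end.

Definition up (sg : nat -> term) : nat -> term :=
  scons (Var 0) (fun n => tlift 1 (sg n)).
Definition upS (rh : nat -> nat) : nat -> nat :=
  scons 0 (fun n => S (rh n)).

(** [sg] substitutes for number variables, [rh] renames set variables. *)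
Fixpoint subst (sg : nat -> term) (rh : nat -> nat) (A : form) : form :=
  match A with
  | Bot => Bot
  | Eq s t => Eq (tsubst sg s) (tsubst sg t)
  | Lt s t => Lt (tsubst sg s) (tsubst sg t)
  | Mem t X => Mem (tsubst sg t) (rh X)
  | Imp B C => Imp (subst sg rh B) (subst sg rh C)
  | And B C => And (subst sg rh B) (subst sg rh C)
  | Or B C => Or (subst sg rh B) (subst sg rh C)
  | All B => All (subst (up sg) rh B)
  | Ex B => Ex (subst (up sg) rh B)
  | AllS B => AllS (subst sg (upS rh) B)
  | ExS B => ExS (subst sg (upS rh) B)
  end.

Definition nsubst (sg : nat -> term) : form -> form := subst sg (fun X => X).

Definition shift : form -> form := nsubst (fun n => Var (S n)).
Definition shiftS : form -> form := subst Var S.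
Definition inst (t : term) : form -> form := nsubst (scons t Var).
Definition instS (X : nat) : form -> form := subst Var (scons X (fun Y => Y)).

(** ** Provability: classical natural deduction

    The nonlogical axioms [T] may contain free variables and may be used in
    every context, so they are implicitly universally closed. *)

Inductive deriv (T : form -> Prop) : list form -> form -> Prop :=
| d_ax G A : T A -> deriv T G A
| d_hyp G A : In A G -> deriv T G A
| d_raa G A : deriv T (Neg A :: G) Bot -> deriv T G A
| d_impI G A B : deriv T (A :: G) B -> deriv T G (Imp A B)
| d_impE G A B : deriv T G (Imp A B) -> deriv T G A -> deriv T G B
| d_andI G A B : deriv T G A -> deriv T G B -> deriv T G (And A B)
| d_andE1 G A B : deriv T G (And A B) -> deriv T G A
| d_andE2 G A B : deriv T G (And A B) -> deriv T G B
| d_orI1 G A B : deriv T G A -> deriv T G (Or A B)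
| d_orI2 G A B : deriv T G B -> deriv T G (Or A B)
| d_orE G A B C :
    deriv T G (Or A B) -> deriv T (A :: G) C -> deriv T (B :: G) C ->
    deriv T G C
| d_allI G A : deriv T (map shift G) A -> deriv T G (All A)
| d_allE G A t : deriv T G (All A) -> deriv T G (inst t A)
| d_exI G A t : deriv T G (inst t A) -> deriv T G (Ex A)
| d_exE G A B :
    deriv T G (Ex A) -> deriv T (A :: map shift G) (shift B) -> deriv T G B
| d_allSI G A : deriv T (map shiftS G) A -> deriv T G (AllS A)
| d_allSE G A X : deriv T G (AllS A) -> deriv T G (instS X A)
| d_exSI G A X : deriv T G (instS X A) -> deriv T G (ExS A)
| d_exSE G A B :
    deriv T G (ExS A) -> deriv T (A :: map shiftS G) (shiftS B) -> deriv T G B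
| d_refl G t : deriv T G (Eq t t)
| d_leib G A s t :
    deriv T G (Eq s t) -> deriv T G (inst s A) -> deriv T G (inst t A).

Definition proves (T : form -> Prop) (A : form) : Prop := deriv T [] A.

Definition extend (T : form -> Prop) (A : form) : form -> Prop :=
  fun B => T B \/ B = A.

(** ** Formula classes *)

(** [Δ^0_0]; the bounding term does not contain the bound variable. *)
Inductive Delta00 : form -> Prop :=
| D_bot : Delta00 Bot
| D_eq s t : Delta00 (Eq s t)
| D_lt s t : Delta00 (Lt s t)
| D_mem t X : Delta00 (Mem t X)
| D_imp A B : Delta00 A -> Delta00 B -> Delta00 (Imp A B)
| D_and A B : Delta00 A -> Delta00 B -> Delta00 (And A B)
| D_or A B : Delta00 A -> Delta00 B -> Delta00 (Or A B)
| D_all t A : Delta00 A -> Delta00 (All ($0 ≺ tlift 1 t ⇒ A))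
| D_ex t A : Delta00 A -> Delta00 (Ex ($0 ≺ tlift 1 t ∧ A)).

Inductive Sigma01 : form -> Prop :=
| S_base A : Delta00 A -> Sigma01 A
| S_ex A : Sigma01 A -> Sigma01 (Ex A).

Inductive Pi01 : form -> Prop :=
| P_base A : Delta00 A -> Pi01 A
| P_all A : Pi01 A -> Pi01 (All A).

Fixpoint set_free (A : form) : Prop :=
  match A with
  | Bot | Eq _ _ | Lt _ _ => True
  | Mem _ _ | AllS _ | ExS _ => False
  | Imp B C | And B C | Or B C => set_free B /\ set_free C
  | All B | Ex B => set_free B
  end.

(** The first-order class [Σ_1] (no set parameters), as opposed to [Σ^0_1]. *)
Definition Sigma1 (A : form) : Prop := Sigma01 A /\ set_free A.

(** All free number variables are [< n]. *)
Fixpoint tbelow (n : nat) (t : term) : Prop :=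
  match t with
  | Var m => m < n
  | Zero | One => True
  | Add s u | Mul s u => tbelow n s /\ tbelow n u
  end.

Fixpoint below (n : nat) (A : form) : Prop :=
  match A with
  | Bot => True
  | Eq s t | Lt s t => tbelow n s /\ tbelow n t
  | Mem t _ => tbelow n t
  | Imp B C | And B C | Or B C => below n B /\ below n C
  | All B | Ex B => below (S n) B
  | AllS B | ExS B => below n B
  end.

(** * Arithmetical notions inside the language

    In the builders below, terms and set indices passed as arguments live in
    the ambient context; they are lifted by hand under each binder. *)

Definition Two : term := One ⊕ One.

Fixpoint numeral (n : nat) : term :=
  match n with 0 => Zero | S m => numeral m ⊕ One end.

Fixpoint tpow (t : term) (k : nat) : term :=
  match k with 0 => One | S j => tpow t j ⊗ t end.

Definition AllLt (t : term) (A : form) : form := All ($0 ≺ tlift 1 t ⇒ A).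

(** Unique existence; in the second copy of [A] variable 0 is the new one and
    the old witness (variable 1) is skipped. *)
Definition Ex1 (A : form) : form :=
  Ex (A ∧ All (nsubst (scons $0 (fun n => $(S (S n)))) A ⇒ $0 ≐ $1)).

(** Gödel's [β(a,b,i) = v], that is, [v = a mod (1 + (i+1) b)]. *)
Definition beta (a b i v : term) : form :=
  let m := One ⊕ (i ⊕ One) ⊗ b in
  v ≺ m ∧ Ex (tlift 1 a ≐ $0 ⊗ tlift 1 m ⊕ tlift 1 v).

(** [p = 2^x]: some [β]-coded sequence starts with 1, doubles at each
    of [x] steps and ends with [p].  ([a] is variable 1 and [b] variable 0
    after the two outer quantifiers; in the body of the bounded quantifier
    [i] is variable 1 and the current entry variable 0.) *)
Definition Pow2 (x p : term) : form :=
  Ex (Ex (beta $1 $0 Zero One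
          ∧ AllLt (tlift 2 x)
              (Ex (beta $3 $2 $1 $0 ∧ beta $3 $2 ($1 ⊕ One) (Two ⊗ $0)))
          ∧ beta $1 $0 (tlift 2 x) (tlift 2 p))).

(** The binary digit of [s] of weight [2^i] is 1. *)
Definition Bit (s i : term) : form :=
  Ex (Pow2 (tlift 1 i) $0
      ∧ Ex (Ex ($0 ≺ $2 ∧ tlift 3 s ≐ (Two ⊗ $1 ⊕ One) ⊗ $2 ⊕ $0))).

(** Finite binary strings: a string [σ] of length [n] is coded by the number
    [2^n + Σ_(i<n) σ(i) 2^i]. *)
Definition Len (s n : term) : form :=
  Ex (Pow2 (tlift 1 n) $0 ∧ $0 ≼ tlift 1 s ∧ tlift 1 s ≺ Two ⊗ $0).

(** [s] is an initial segment of [t]. *)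
Definition Init (s t : term) : form :=
  Ex (Ex (Len (tlift 2 s) $1 ∧ Len (tlift 2 t) $0 ∧ $1 ≼ $0
          ∧ AllLt $1 (Bit (tlift 3 s) $0 ⇔ Bit (tlift 3 t) $0))).

Definition pair (x y : term) : term := (x ⊕ y) ⊗ (x ⊕ y) ⊕ x.

Definition Subset (X Y : nat) : form := All ($0 ∈ X ⇒ $0 ∈ Y).
Definition Unbounded (X : nat) : form := All (Ex ($1 ≺ $0 ∧ $0 ∈ X)).
Definition Finite (X : nat) : form := Ex (All ($0 ∈ X ⇒ $0 ≺ $1)).

(** [|X| = x]: there is (the graph of) a bijection from [{i : i < x}] to [X]. *)
Definition Card (X : nat) (x : term) : form :=
  ExS (All (All (pair $1 $0 ∈ 0 ⇒ $1 ≺ tlift 2 x ∧ $0 ∈ S X))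
       ∧ AllLt x (Ex1 (pair $1 $0 ∈ 0))
       ∧ All ($0 ∈ S X ⇒ Ex1 (pair $0 $1 ∈ 0))).

(** [x ∈ I^0_1]. *)
Definition I01 (x : term) : form :=
  AllS (Unbounded 0 ⇒ ExS (Subset 0 1 ∧ Finite 0 ∧ Card 0 x)).

(** * The theories *)

Inductive RCA0s : form -> Prop :=
| R_succ_nz : RCA0s (¬ ($0 ⊕ One ≐ Zero))
| R_succ_inj : RCA0s ($0 ⊕ One ≐ $1 ⊕ One ⇒ $0 ≐ $1)
| R_add0 : RCA0s ($0 ⊕ Zero ≐ $0)
| R_addS : RCA0s ($0 ⊕ ($1 ⊕ One) ≐ ($0 ⊕ $1) ⊕ One)
| R_mul0 : RCA0s ($0 ⊗ Zero ≐ Zero)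
| R_mulS : RCA0s ($0 ⊗ ($1 ⊕ One) ≐ $0 ⊗ $1 ⊕ $0)
| R_lt0 : RCA0s (¬ ($0 ≺ Zero))
| R_ltS : RCA0s ($0 ≺ $1 ⊕ One ⇔ $0 ≺ $1 ∨ $0 ≐ $1)
| R_exp : RCA0s (All (Ex (Pow2 $1 $0)))
| R_ind A : Delta00 A ->
    RCA0s (inst Zero A
           ∧ All (A ⇒ nsubst (scons ($0 ⊕ One) (fun n => $(S n))) A)
           ⇒ All A)
| R_comp A B : Sigma01 A -> Pi01 B ->
    RCA0s (All (A ⇔ B) ⇒ ExS (All ($0 ∈ 0 ⇔ shiftS A))).

(** Every infinite tree [T ⊆ 2^{<N}] has an infinite path: a set [X] all of
    whose initial segments [X↾n] are in [T].  [T] is set variable 0 in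
    [BinTree]; it is set variable 1 and [X] set variable 0 in [WKL]. *)
Definition BinTree : form :=
  All ($0 ∈ 0 ⇒ Ex (Len $1 $0))
  ∧ All (All ($0 ∈ 0 ∧ Init $1 $0 ⇒ $1 ∈ 0)).

Definition WKL : form :=
  AllS (BinTree ∧ Unbounded 0 ⇒
        ExS (All (Ex ($0 ∈ 1 ∧ Len $0 $1 ∧ AllLt $1 (Bit $1 $0 ⇔ $0 ∈ 0))))).

Definition WKL0s : form -> Prop := extend RCA0s WKL.

(** A relation [⪯] on the numbers is a set [R] of pairs. *)
Definition Partial_order (R : nat) : form :=
  All (pair $0 $0 ∈ R)
  ∧ All (All (pair $0 $1 ∈ R ∧ pair $1 $0 ∈ R ⇒ $0 ≐ $1))
  ∧ All (All (All (pair $0 $1 ∈ R ∧ pair $1 $2 ∈ R ⇒ pair $0 $2 ∈ R))).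

Definition Linear_order (R : nat) : form :=
  Partial_order R ∧ All (All (pair $0 $1 ∈ R ∨ pair $1 $0 ∈ R)).

Definition Chain (R X : nat) : form :=
  All (All ($0 ∈ X ∧ $1 ∈ X ⇒ pair $0 $1 ∈ R ∨ pair $1 $0 ∈ R)).

Definition Antichain (R X : nat) : form :=
  All (All ($0 ∈ X ∧ $1 ∈ X ∧ ¬ ($0 ≐ $1) ⇒
            ¬ (pair $0 $1 ∈ R ∨ pair $1 $0 ∈ R))).

Definition CAC : form :=
  AllS (Partial_order 0 ⇒ ExS (Unbounded 0 ∧ (Chain 1 0 ∨ Antichain 1 0))).

Definition Ascending (R X : nat) : form :=
  All (All ($0 ∈ X ∧ $1 ∈ X ⇒ ($0 ≼ $1 ⇔ pair $0 $1 ∈ R))).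

Definition Descending (R X : nat) : form :=
  All (All ($0 ∈ X ∧ $1 ∈ X ⇒ ($0 ≼ $1 ⇔ pair $1 $0 ∈ R))).

Definition ADS : form :=
  AllS (Linear_order 0 ⇒
        ExS (Unbounded 0 ∧ (Ascending 1 0 ∨ Descending 1 0))).

(** * Definable functions *)

(** [g] is a [Σ_1] definition of (the graph of) a function: its only free
    variables are 0, the argument, and 1, the value, and [RCA0s] proves that
    it defines a total function. *)
Definition Sigma1_function (g : form) : Prop :=
  Sigma1 g /\ below 2 g /\
  proves RCA0s (All (Ex1 (nsubst (scons $1 (scons $0 Var)) g))).

(** [P(g(t))]; in [P], number variable 0 stands for the value [g(t)] and the
    ambient variables are shifted by one. *)
Definition at_value (g : form) (t : term) (P : form) : form :=
  Ex (nsubst (scons (tlift 1 t) (scons $0 Var)) g ∧ P).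

(** [∀ x ≥ n, g(x) ≥ x^k]. *)
Definition grows (g : form) (n k : nat) : form :=
  All (numeral n ≼ $0 ⇒ at_value g $0 (tpow $1 k ≼ $0)).

(** [∀ x (x ∈ I^0_1 → g(x) ∈ I^0_1)]. *)
Definition I01_closed_under (g : form) : form :=
  All (I01 $0 ⇒ at_value g $0 (I01 $0)).

(* Main.v *)
(** Take a nonprincipal ultrafilter on [nat] and work with sequences modulo it.  Let [G] be the
    function defined by [g] and [h] a function dominating the least witnesses of every arithmetical
    formula.  Starting from the [h]-spaced set [S_0(n) = {h^j(n) : j < G n}], shrink it step by step to
    [S_k(n)], at each step (for one of countably many named sets [p])
    - making it homogeneous for [p], read as a transitive relation (Erdos-Szekeres, a square root
      in cardinality), and
    - either putting [n] elements of [p] below it or making it avoid [p] inside its convex hull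
      (pigeonhole, a factor [n + 1] in cardinality).
    Since [G] is superpolynomial, [S_k(n)] keeps at least [n^m] elements for every [m].  The cut of named
    numbers lying below some [min S_k] is closed under [h], hence an elementary substructure of the
    ultrapower, and with the traces of the named sets it satisfies [WKL_0^*].  It satisfies CAC and ADS
    because every [S_k] is unbounded in it, and the number [n |-> n] is in [I^0_1] by the second
    item, whereas [G] of it is not: [S_0] is unbounded, but each of its bounded parts has fewer
    than [G n] elements. *)

From Stdlib Require Import List Arith Cantor Lia Bool Classical ClassicalEpsilon FunctionalExtensionality.
From mathcomp Require filter.
Require Import Defs.
Import ListNotations.

(** The growth hypothesis matches the cost of the construction. One shrinking step takes two square
    roots of the cardinality, one for each direction in which a relation can order x < y, and
    divides by n + 1. Keeping n^m elements thus costs n^(4(m+3)) beforehand, which is affordable for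
    any fixed number of steps because G eventually exceeds every power of n.

    The main obstacle is that a set of the model behaves as a transitive relation or as a tree on
    the cut only, while its component at an index n may be arbitrary. Every construction is
    therefore made total on arbitrary components, by cutting relations off at the first failure or
    by asking strings to be good. Bounded formulas, which are absolute between cut and ultrapower,
    then show that components behave well up to any given element of the cut.

    Naming serves two ends: the sets can be enumerated, so each is treated at some stage, and the
    names are closed under least witnesses and under the construction itself, so stages, paths and
    counting bijections are again sets of the model. *)

(** * Classical tools and a nonprincipal ultrafilter *)

Definition pbool (P : Prop) : bool := if excluded_middle_informative P then true else false.

Lemma pboolP (P : Prop) : pbool P = true <-> P.
Proof. unfold pbool; destruct (excluded_middle_informative P); split; congruence || tauto. Qed.

Lemma ex_least (P : nat -> Prop) : (exists y, P y) -> exists y, P y /\ forall z, z < y -> ~ P z.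
Proof.
  intros [y Hy]. revert Hy. induction y as [y IH] using (well_founded_induction lt_wf). intros Hy.
  destruct (classic (exists z, z < y /\ P z)) as [[z [Hz Pz]]|N].
  - eauto.
  - exists y; split; auto. intros z Hz Pz. apply N; eauto.
Qed.

Lemma ex_max (P : nat -> Prop) (b : nat) :
  (exists y, P y) -> (forall y, P y -> y <= b) -> exists y, P y /\ forall z, P z -> z <= y.
Proof.
  intros [y0 H0] Hb.
  destruct (ex_least (fun d => P (b - d) /\ d <= b)) as [d [[Hd Hdb] Hmin]].
  - exists (b - y0). specialize (Hb _ H0). split; [|lia]. now replace (b - (b - y0)) with y0 by lia.
  - exists (b - d). split; auto. intros z Pz. specialize (Hb _ Pz).
    destruct (le_lt_dec z (b - d)); auto. exfalso. apply (Hmin (b - z)); [lia|].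
    split; [|lia]. now replace (b - (b - z)) with z by lia.
Qed.

Definition least (P : nat -> Prop) : nat :=
  epsilon (inhabits 0) (fun y => P y /\ forall z, z < y -> ~ P z).

Lemma least_spec (P : nat -> Prop) : (exists y, P y) -> P (least P) /\ forall z, z < least P -> ~ P z.
Proof. intros H. apply (epsilon_spec (inhabits 0) _ (ex_least P H)). Qed.

Lemma least_le (P : nat -> Prop) (y : nat) : P y -> least P <= y.
Proof.
  intros H. destruct (least_spec P (ex_intro _ y H)) as [_ L].
  destruct (le_lt_dec (least P) y); auto. destruct (L _ l H).
Qed.

Lemma least_eq v : least (fun y => y = v) = v.
Proof. apply (least_spec (fun y => y = v)). eauto. Qed.

(** Obtained by refining the Frechet filter [F]; the last clause is nonprincipality in the form in
    which it is used. *)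
Lemma ultrafilter_nat : exists U : (nat -> Prop) -> Prop,
  (forall P Q, U P -> (forall n, P n -> Q n) -> U Q) /\
  (forall P Q, U P -> U Q -> U (fun n => P n /\ Q n)) /\
  (forall P, U P \/ U (fun n => ~ P n)) /\
  ~ U (fun _ => False) /\
  (forall k, U (fun n => k <= n)).
Proof.
  set (F := fun P : nat -> Prop => exists N, forall n, N <= n -> P n).
  assert (PF : filter.ProperFilter F).
  { constructor.
    - intros [N HN]. exact (HN N (le_n _)).
    - constructor.
      + now exists 0.
      + intros P Q [N HN] [M HM]. exists (N + M). intros n Hn. split; [apply HN|apply HM]; lia.
      + intros P Q S [N HN]. exists N. intros n Hn. apply S, HN, Hn. }
  destruct (filter.ultraFilterLemma PF) as [U [UU FU]].
  destruct (filter.ultra_proper (F := U)) as [ne Fi].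
  exists U. split; [|split; [|split; [|split]]].
  - intros P Q HP S. apply (@filter.filterS _ U Fi P Q); auto.
  - intros P Q HP HQ. apply (@filter.filterI _ U Fi P Q HP HQ).
  - intros P. apply (@filter.in_ultra_setVsetC _ U P UU).
  - exact ne.
  - intros k. apply FU. exists k. auto.
Qed.

(** * Tarskian semantics *)

(** Equality is interpreted by a relation [eqv]: the numbers of the model built later are names,
    equal when their values agree modulo the ultrafilter, and no quotient is formed. *)
Record structure := {
  dom : Type; sets : Type;
  zero : dom; one : dom; add : dom -> dom -> dom; mul : dom -> dom -> dom;
  eqv : dom -> dom -> Prop; lt : dom -> dom -> Prop; mem : dom -> sets -> Prop }.

Record congruent (M : structure) : Prop := {
  eqv_refl : forall x : dom M, eqv M x x;
  eqv_sym : forall x y : dom M, eqv M x y -> eqv M y x;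
  eqv_trans : forall x y z : dom M, eqv M x y -> eqv M y z -> eqv M x z;
  add_eqv : forall x x' y y', eqv M x x' -> eqv M y y' -> eqv M (add M x y) (add M x' y');
  mul_eqv : forall x x' y y', eqv M x x' -> eqv M y y' -> eqv M (mul M x y) (mul M x' y');
  lt_eqv : forall x x' y y', eqv M x x' -> eqv M y y' -> lt M x y -> lt M x' y';
  mem_eqv : forall x x' X, eqv M x x' -> mem M x X -> mem M x' X }.

Fixpoint eval (M : structure) (e : nat -> dom M) (t : term) : dom M :=
  match t with
  | Var n => e n
  | Zero => zero M
  | One => one M
  | Add s t => add M (eval M e s) (eval M e t)
  | Mul s t => mul M (eval M e s) (eval M e t)
  end.

Fixpoint sat (M : structure) (e : nat -> dom M) (E : nat -> sets M) (A : form) : Prop :=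
  match A with
  | Bot => False
  | Eq s t => eqv M (eval M e s) (eval M e t)
  | Lt s t => lt M (eval M e s) (eval M e t)
  | Mem t X => mem M (eval M e t) (E X)
  | Imp B C => sat M e E B -> sat M e E C
  | And B C => sat M e E B /\ sat M e E C
  | Or B C => sat M e E B \/ sat M e E C
  | All B => forall d, sat M (scons d e) E B
  | Ex B => exists d, sat M (scons d e) E B
  | AllS B => forall X, sat M e (scons X E) B
  | ExS B => exists X, sat M e (scons X E) B
  end.

Lemma eval_tsubst M e sg t : eval M e (tsubst sg t) = eval M (fun n => eval M e (sg n)) t.
Proof. induction t; simpl; congruence. Qed.

Lemma eval_shift M d e t : eval M (scons d e) (tlift 1 t) = eval M e t.
Proof. unfold tlift. now rewrite eval_tsubst. Qed.

Lemma sat_subst M A : forall e E sg rh,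
  sat M e E (subst sg rh A) <-> sat M (fun n => eval M e (sg n)) (fun X => E (rh X)) A.
Proof.
  assert (U : forall e sg d, (fun n => eval M (scons d e) (up sg n)) = scons d (fun n => eval M e (sg n))).
  { intros e sg d. extensionality n. destruct n; simpl; auto. apply eval_shift. }
  assert (US : forall (E : nat -> sets M) rh X, (fun Y => scons X E (upS rh Y)) = scons X (fun Y => E (rh Y))).
  { intros E rh X. extensionality Y. now destruct Y. }
  induction A; intros e E sg rh; simpl; rewrite ?eval_tsubst; try tauto;
    try (rewrite IHA1, IHA2; tauto).
  - split; intros H d; specialize (H d); rewrite IHA, U in *; auto.
  - split; intros [d H]; exists d; rewrite IHA, U in *; auto.
  - split; intros H d; specialize (H d); rewrite IHA, US in *; auto.
  - split; intros [d H]; exists d; rewrite IHA, US in *; auto.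
Qed.

Definition swap (i : nat) : term := match i with 0 => Var 1 | 1 => Var 0 | _ => Var i end.

Lemma sat_swap M x y e E A : sat M (scons x (scons y e)) E (nsubst swap A) <-> sat M (scons y (scons x e)) E A.
Proof.
  unfold nsubst. rewrite sat_subst.
  replace (fun n => eval M (scons x (scons y e)) (swap n)) with (scons y (scons x e)); [tauto|].
  extensionality i. now destruct i as [|[|i]].
Qed.

Lemma eval_congr M (C : congruent M) e e' t :
  (forall n, eqv M (e n) (e' n)) -> eqv M (eval M e t) (eval M e' t).
Proof.
  intros H. induction t; simpl; auto using eqv_refl, add_eqv, mul_eqv.
Qed.

Lemma sat_congr M (C : congruent M) A : forall e e' E,
  (forall n, eqv M (e n) (e' n)) -> (sat M e E A <-> sat M e' E A).
Proof.
  assert (S : forall e e' (d : dom M), (forall n, eqv M (e n) (e' n)) ->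
    forall n, eqv M (scons d e n) (scons d e' n)).
  { intros e e' d H [|n]; simpl; auto using eqv_refl. }
  induction A; intros e e' E H; simpl; try tauto;
    try (rewrite (IHA1 e e' E H), (IHA2 e e' E H); tauto).
  - pose proof (eval_congr M C e e' s H). pose proof (eval_congr M C e e' t H).
    split; intros; eauto using eqv_trans, eqv_sym.
  - pose proof (eval_congr M C e e' s H). pose proof (eval_congr M C e e' t H).
    split; apply lt_eqv; auto using eqv_sym.
  - pose proof (eval_congr M C e e' t H).
    split; apply mem_eqv; auto using eqv_sym.
  - split; intros K d; apply (IHA (scons d e) (scons d e') E (S _ _ d H)); auto.
  - split; intros [d K]; exists d; apply (IHA (scons d e) (scons d e') E (S _ _ d H)); auto.
  - split; intros K X; apply (IHA e e' _ H); auto.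
  - split; intros [X K]; exists X; apply (IHA e e' _ H); auto.
Qed.

Lemma sat_shift M d e E A : sat M (scons d e) E (shift A) <-> sat M e E A.
Proof. unfold shift, nsubst. now rewrite sat_subst. Qed.

Lemma sat_shiftS M X e E A : sat M e (scons X E) (shiftS A) <-> sat M e E A.
Proof. unfold shiftS. now rewrite sat_subst. Qed.

Lemma sat_inst M e E t A : sat M e E (inst t A) <-> sat M (scons (eval M e t) e) E A.
Proof.
  unfold inst, nsubst. rewrite sat_subst.
  replace (fun n => eval M e (scons t Var n)) with (scons (eval M e t) e); [reflexivity|].
  extensionality n. now destruct n.
Qed.

Lemma sat_instS M e E X A : sat M e E (instS X A) <-> sat M e (scons (E X) E) A.
Proof.
  unfold instS. rewrite sat_subst.
  replace (fun n => E (scons X (fun Y => Y) n)) with (scons (E X) E); [reflexivity|].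
  extensionality n. now destruct n.
Qed.

(** Axioms are assumed true under every assignment, in line with their implicit universal closure.
    The two equality rules are where [eqv] has to be a congruence. *)
Theorem soundness M (C : congruent M) T G A :
  deriv T G A -> (forall B, T B -> forall e E, sat M e E B) ->
  forall e E, (forall B, In B G -> sat M e E B) -> sat M e E A.
Proof.
  intros D HT. induction D; intros e E HG; simpl in *.
  - auto.
  - auto.
  - apply NNPP. intros N. apply (IHD e E). intros B [<-|HB]; auto.
  - intros HA. apply IHD. intros B' [<-|HB]; auto.
  - apply IHD1; auto.
  - auto.
  - now apply IHD.
  - now apply IHD.
  - left; auto.
  - right; auto.
  - destruct (IHD1 e E HG).
    + apply IHD2. intros B' [<-|HB]; auto.
    + apply IHD3. intros B' [<-|HB]; auto.
  - intros d. apply IHD. intros B HB. apply in_map_iff in HB as [B' [<- HB]].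
    apply sat_shift; auto.
  - apply sat_inst. apply IHD; auto.
  - exists (eval M e t). apply sat_inst. auto.
  - destruct (IHD1 e E HG) as [d Hd]. apply (sat_shift M d). apply IHD2.
    intros B' [<-|HB]; auto. apply in_map_iff in HB as [B'' [<- HB]]. apply sat_shift; auto.
  - intros X. apply IHD. intros B HB. apply in_map_iff in HB as [B' [<- HB]].
    apply sat_shiftS; auto.
  - apply sat_instS. apply IHD; auto.
  - exists (E X). apply sat_instS. auto.
  - destruct (IHD1 e E HG) as [X HX]. apply (sat_shiftS M X). apply IHD2.
    intros B' [<-|HB]; auto. apply in_map_iff in HB as [B'' [<- HB]]. apply sat_shiftS; auto.
  - apply eqv_refl; auto.
  - apply sat_inst. specialize (IHD2 e E HG). apply sat_inst in IHD2.
    eapply sat_congr; [auto| |exact IHD2]. intros [|n]; simpl; [apply (eqv_sym M C), (IHD1 e E HG)|apply (eqv_refl M C)].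
Qed.

Lemma sat_Ex1 M e E A : sat M e E (Ex1 A) <->
  exists w, sat M (scons w e) E A /\ forall y, sat M (scons y e) E A -> eqv M y w.
Proof.
  assert (K : forall w y, sat M (scons y (scons w e)) E (nsubst (scons (Var 0) (fun n => Var (S (S n)))) A) <->
    sat M (scons y e) E A).
  { intros w y. unfold nsubst. rewrite sat_subst.
    replace (fun n => eval M (scons y (scons w e)) (scons (Var 0) (fun n0 => Var (S (S n0))) n)) with (scons y e);
      [reflexivity|].
    extensionality i. now destruct i. }
  unfold Ex1. cbn [sat]. split; intros [w [Hw Hu]]; exists w; split; auto; intros y Hy; apply Hu, (K w), Hy.
Qed.

Lemma eval_local M t k : tbelow k t -> forall e e', (forall i, i < k -> e i = e' i) ->
  eval M e t = eval M e' t.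
Proof.
  intros B e e' H. induction t; simpl in *; auto; destruct B; rewrite IHt1, IHt2; auto.
Qed.

Lemma sat_local M A : forall k, below k A -> set_free A -> forall e e' E E',
  (forall i, i < k -> e i = e' i) -> (sat M e E A <-> sat M e' E' A).
Proof.
  assert (S : forall k e e' (d : dom M), (forall i, i < k -> e i = e' i) ->
    forall i, i < S k -> scons d e i = scons d e' i).
  { intros k e e' d H [|i] Hi; simpl; auto. apply H. lia. }
  induction A; intros k B F e e' E E' H; simpl in *; try tauto.
  - destruct B. rewrite (eval_local M s k) with (e' := e'), (eval_local M t k) with (e' := e'); tauto.
  - destruct B. rewrite (eval_local M s k) with (e' := e'), (eval_local M t k) with (e' := e'); tauto.
  - destruct B, F. rewrite (IHA1 k) with (e' := e') (E' := E'), (IHA2 k) with (e' := e') (E' := E'); tauto.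
  - destruct B, F. rewrite (IHA1 k) with (e' := e') (E' := E'), (IHA2 k) with (e' := e') (E' := E'); tauto.
  - destruct B, F. rewrite (IHA1 k) with (e' := e') (E' := E'), (IHA2 k) with (e' := e') (E' := E'); tauto.
  - split; intros K d; eapply (IHA _ B F _ _ _ _ (S k e e' d H)); eauto.
  - split; intros [d K]; exists d; eapply (IHA _ B F _ _ _ _ (S k e e' d H)); eauto.
Qed.

(** This is what allows the parameters of a formula, numbers and sets alike, to be packed into the
    finite argument lists of a name. *)
Lemma sat_finite_support M A : exists k, forall e e' E E',
  (forall i, i < k -> e i = e' i) -> (forall i, i < k -> E i = E' i) ->
  (sat M e E A <-> sat M e' E' A).
Proof.
  assert (T : forall t, exists k, tbelow k t).
  { assert (mono : forall t k k', tbelow k t -> k <= k' -> tbelow k' t).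
    { induction t; simpl; intuition; eauto; lia. }
    induction t; simpl; try (now exists 0).
    - exists (S n). lia.
    - destruct IHt1 as [k1 H1], IHt2 as [k2 H2]. exists (k1 + k2).
      split; eapply mono; eauto; lia.
    - destruct IHt1 as [k1 H1], IHt2 as [k2 H2]. exists (k1 + k2).
      split; eapply mono; eauto; lia. }
  assert (SC : forall (X : Type) k (e e' : nat -> X) d, (forall i, i < k -> e i = e' i) ->
    forall i, i < S k -> scons d e i = scons d e' i).
  { intros X k e e' d H [|i] Hi; simpl; auto. apply H. lia. }
  induction A.
  - exists 0. simpl. tauto.
  - destruct (T s) as [k1 H1], (T t) as [k2 H2]. exists (k1 + k2). intros e e' E E' He HE. simpl.
    rewrite (eval_local M s k1 H1 e e'), (eval_local M t k2 H2 e e'); [tauto| |]; intros; apply He; lia.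
  - destruct (T s) as [k1 H1], (T t) as [k2 H2]. exists (k1 + k2). intros e e' E E' He HE. simpl.
    rewrite (eval_local M s k1 H1 e e'), (eval_local M t k2 H2 e e'); [tauto| |]; intros; apply He; lia.
  - destruct (T t) as [k H]. exists (k + S X). intros e e' E E' He HE. simpl.
    rewrite (eval_local M t k H e e'), (HE X); [tauto|lia|]; intros; apply He; lia.
  - destruct IHA1 as [k1 H1], IHA2 as [k2 H2]. exists (k1 + k2). intros e e' E E' He HE. simpl.
    rewrite (H1 e e' E E'), (H2 e e' E E'); try tauto; intros; (apply He || apply HE); lia.
  - destruct IHA1 as [k1 H1], IHA2 as [k2 H2]. exists (k1 + k2). intros e e' E E' He HE. simpl.
    rewrite (H1 e e' E E'), (H2 e e' E E'); try tauto; intros; (apply He || apply HE); lia.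
  - destruct IHA1 as [k1 H1], IHA2 as [k2 H2]. exists (k1 + k2). intros e e' E E' He HE. simpl.
    rewrite (H1 e e' E E'), (H2 e e' E E'); try tauto; intros; (apply He || apply HE); lia.
  - destruct IHA as [k H]. exists k. intros e e' E E' He HE. simpl.
    split; intros K d; eapply (H (scons d e) (scons d e')); eauto; intros; eapply SC; eauto.
  - destruct IHA as [k H]. exists k. intros e e' E E' He HE. simpl.
    split; intros [d K]; exists d; eapply (H (scons d e) (scons d e')); eauto; intros; eapply SC; eauto.
  - destruct IHA as [k H]. exists k. intros e e' E E' He HE. simpl.
    split; intros K d; eapply (H _ _ (scons d E) (scons d E')); eauto; intros; eapply SC; eauto.
  - destruct IHA as [k H]. exists k. intros e e' E E' He HE. simpl.
    split; intros [d K]; exists d; eapply (H _ _ (scons d E) (scons d E')); eauto; intros; eapply SC; eauto.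
Qed.

(** * The standard model *)

Definition NS : structure := {|
  dom := nat; sets := nat -> bool; zero := 0; one := 1; add := Nat.add; mul := Nat.mul;
  eqv := eq; lt := Nat.lt; mem := fun x X => X x = true |}.

Notation evalN := (eval NS).
Notation satN := (sat NS).

Lemma NS_congruent : congruent NS.
Proof. constructor; simpl; intros; subst; auto. Qed.

Lemma evalN_tlift k t e e' : (forall n, e' (k + n) = e n) -> evalN e' (tlift k t) = evalN e t.
Proof.
  intros H. unfold tlift. rewrite eval_tsubst. f_equal. extensionality n. apply H.
Qed.

(** * Coded sequences and binary strings in the standard model *)

Definition moddef (a b i : nat) : nat := a mod (1 + (i + 1) * b).

Lemma sat_beta e E a b i v :
  satN e E (beta a b i v) <-> evalN e v = moddef (evalN e a) (evalN e b) (evalN e i).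
Proof.
  unfold beta. cbn [sat eval]. cbn [lt eqv add mul one NS].
  assert (L : forall d t, evalN (scons d e) (tlift 1 t) = evalN e t) by (intros; apply evalN_tlift; auto).
  unfold moddef. set (A := evalN e a). set (B := evalN e b). set (I := evalN e i). set (V := evalN e v).
  split.
  - intros [HV [q Hq]]. rewrite !L in Hq. cbn in Hq. fold A B I V in Hq.
    change (A = q * (1 + (I + 1) * B) + V) in Hq. change (V < 1 + (I + 1) * B) in HV.
    apply (Nat.mod_unique _ _ q); lia.
  - intros HV. change (V < 1 + (I + 1) * B /\ exists q,
      evalN (scons q e) (tlift 1 a) = q * evalN (scons q e) (tlift 1 (One ⊕ (i ⊕ One) ⊗ b)%form) +
      evalN (scons q e) (tlift 1 v)).
    split.
    + rewrite HV. apply Nat.mod_upper_bound. lia.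
    + exists (A / (1 + (I + 1) * B)). rewrite !L. cbn. fold A B I V. rewrite HV.
      pose proof (Nat.div_mod A (1 + (I + 1) * B) ltac:(lia)). cbn in *. lia.
Qed.

Lemma coprime_mul a b c : Nat.gcd a c = 1 -> Nat.gcd b c = 1 -> Nat.gcd (a * b) c = 1.
Proof.
  intros Ha Hb. set (d := Nat.gcd (a * b) c).
  assert (D1 : Nat.divide d (a * b)) by apply Nat.gcd_divide_l.
  assert (D2 : Nat.divide d c) by apply Nat.gcd_divide_r.
  assert (K : forall x, Nat.divide x 1 -> x = 1) by apply Nat.divide_1_r.
  assert (C : Nat.gcd d a = 1).
  { apply K. rewrite <- Ha. apply Nat.gcd_greatest; [apply Nat.gcd_divide_r|].
    apply (Nat.divide_trans _ d); auto. apply Nat.gcd_divide_l. }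
  apply K. rewrite <- Hb. apply Nat.gcd_greatest; auto. apply (Nat.gauss _ _ _ D1 C).
Qed.

Lemma chinese (m v : nat -> nat) n :
  (forall i j, i < j < n -> Nat.gcd (m i) (m j) = 1) -> (forall i, i < n -> v i < m i) ->
  exists a, forall i, i < n -> a mod m i = v i.
Proof.
  intros Hc Hv.
  (* The induction carries a common multiple [P] of the moduli met so far that is coprime to
     whatever is coprime to all of them, so that Bezout applies to [P] and the next modulus. *)
  assert (H : exists a P, (forall i, i < n -> a mod m i = v i) /\ P <> 0 /\ (forall i, i < n -> Nat.divide (m i) P) /\
    forall q, (forall i, i < n -> Nat.gcd (m i) q = 1) -> Nat.gcd P q = 1).
  { induction n as [|n IH].
    - exists 0, 1. repeat split; intros; lia || auto.
    - destruct IH as (a & P & H1 & H0 & H2 & H3); [intros; apply Hc; lia|intros; apply Hv; lia|].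
      assert (Hm : m n <> 0) by (specialize (Hv n (le_n _)); lia).
      assert (cop : Nat.gcd P (m n) = 1) by (apply H3; intros; apply Hc; lia).
      destruct (Nat.gcd_bezout_pos P (m n)) as [x [y Hxy]]; [lia|]. rewrite cop in Hxy.
      (* [x * P = 1 + y * m n], so adding [k * x * P] moves the residue mod [m n] by [k]. *)
      exists (a + (v n + a * (m n - 1)) * (x * P)), (P * m n).
      repeat split.
      + intros i Hi. destruct (Nat.eq_dec i n) as [->|Hne].
        * assert (Hvn := Hv n (le_n _)).
          replace (a + (v n + a * (m n - 1)) * (x * P)) with (v n + (a + (v n + a * (m n - 1)) * y) * m n)
            by (rewrite Hxy; destruct (m n); [lia|]; simpl; rewrite Nat.sub_0_r; lia).
          rewrite Nat.Div0.mod_add. apply Nat.mod_small; auto.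
        * destruct (H2 i) as [z Hz]; [lia|]. rewrite Hz.
          replace (a + (v n + a * (m n - 1)) * (x * (z * m i))) with (a + ((v n + a * (m n - 1)) * x * z) * m i) by lia.
          rewrite Nat.Div0.mod_add. apply H1; lia.
      + nia.
      + intros i Hi. destruct (Nat.eq_dec i n) as [->|Hne].
        * exists P; auto.
        * apply Nat.divide_mul_l. apply H2; lia.
      + intros q Hq. apply coprime_mul; [apply H3; intros; apply Hq; lia|apply Hq; lia]. }
  destruct H as (a & _ & H & _). eauto.
Qed.

Lemma divide_fact i n : 1 <= i <= n -> Nat.divide i (fact n).
Proof.
  induction n as [|n IH]; [lia|]. intros Hi. change (fact (S n)) with (S n * fact n).
  destruct (Nat.eq_dec i (S n)) as [->|].
  - apply Nat.divide_factor_l.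
  - apply Nat.divide_mul_r, IH. lia.
Qed.

(** With b = B! the moduli are pairwise coprime: a common divisor of two of them is coprime to B!
    and divides (j - i) B!, hence divides j - i and so B! itself. Choosing B above n and all entries
    also makes the moduli exceed the entries. *)
Lemma beta_exists (v : nat -> nat) n : exists a b, forall i, i < n -> moddef a b i = v i.
Proof.
  assert (HB : exists B, n <= B /\ forall i, i < n -> v i <= B).
  { clear. induction n as [|n [B [H1 H2]]].
    - exists 0. split; [lia|intros; lia].
    - exists (B + v n + 1). split; [lia|]. intros i Hi.
      destruct (Nat.eq_dec i n) as [->|]; [lia|]. specialize (H2 i ltac:(lia)). lia. }
  destruct HB as [B [HnB HB]].
  assert (Hf : B <= fact B).
  { clear. induction B; [lia|]. pose proof (lt_O_fact B). change (fact (S B)) with (S B * fact B). nia. }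
  pose proof (lt_O_fact B) as Hpos.
  destruct (chinese (fun i => 1 + (i + 1) * fact B) v n) as [a Ha].
  - intros i j Hij.
    set (d := Nat.gcd _ _).
    assert (D1 : Nat.divide d (1 + (i + 1) * fact B)) by apply Nat.gcd_divide_l.
    assert (D2 : Nat.divide d (1 + (j + 1) * fact B)) by apply Nat.gcd_divide_r.
    assert (D3 : Nat.divide d ((j - i) * fact B)).
    { replace ((j - i) * fact B) with ((1 + (j + 1) * fact B) - (1 + (i + 1) * fact B)) by nia.
      now apply Nat.divide_sub_r. }
    assert (C : Nat.gcd d (fact B) = 1).
    { set (e := Nat.gcd d (fact B)).
      assert (E1 : Nat.divide e d) by apply Nat.gcd_divide_l.
      assert (E2 : Nat.divide e (fact B)) by apply Nat.gcd_divide_r.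
      assert (E3 : Nat.divide e 1).
      { apply (Nat.divide_add_cancel_r e ((i + 1) * fact B)).
        - now apply Nat.divide_mul_r.
        - rewrite Nat.add_comm. now apply (Nat.divide_trans _ d). }
      now apply Nat.divide_1_r in E3. }
    assert (D4 : Nat.divide d (j - i)).
    { rewrite Nat.mul_comm in D3. apply (Nat.gauss _ _ _ D3 C). }
    assert (D5 : Nat.divide d (fact B)).
    { apply (Nat.divide_trans _ (j - i)); auto. apply divide_fact. lia. }
    apply Nat.divide_gcd_iff in D5. now rewrite D5 in C.
  - intros i Hi. specialize (HB i Hi). nia.
  - exists a, (fact B). exact Ha.
Qed.

Lemma sat_Pow2 e E x p : satN e E (Pow2 x p) <-> evalN e p = 2 ^ evalN e x.
Proof.
  set (X := evalN e x). set (P := evalN e p).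
  assert (H : satN e E (Pow2 x p) <-> exists a b, 1 = moddef a b 0 /\
    (forall i, i < X -> exists u, u = moddef a b i /\ 2 * u = moddef a b (i + 1)) /\ P = moddef a b X).
  { unfold Pow2, AllLt. cbn [sat].
    assert (Lx : forall a b, evalN (scons b (scons a e)) (tlift 2 x) = X) by (intros; apply evalN_tlift; auto).
    assert (Lp : forall a b, evalN (scons b (scons a e)) (tlift 2 p) = P) by (intros; apply evalN_tlift; auto).
    split.
    - intros (a & b & H1 & H2 & H3). exists a, b.
      apply sat_beta in H1, H3. rewrite Lx, Lp in H3. split; [exact H1|split; [|exact H3]].
      intros i Hi. destruct (H2 i) as [u [Hu Hu']].
      + cbn. rewrite (evalN_tlift 1 (tlift 2 x) (scons b (scons a e))), Lx; auto.
      + apply sat_beta in Hu, Hu'. exists u. split; [exact Hu|exact Hu'].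
    - intros (a & b & H1 & H2 & H3). exists a, b. rewrite !sat_beta, Lx, Lp. split; [exact H1|split; [|exact H3]].
      intros i Hi. cbn in Hi. rewrite (evalN_tlift 1 (tlift 2 x) (scons b (scons a e))), Lx in Hi; auto.
      destruct (H2 i Hi) as [u [Hu Hu']]. exists u. rewrite !sat_beta. split; [exact Hu|exact Hu']. }
  rewrite H. split.
  - intros (a & b & H1 & H2 & ->).
    assert (K : forall i, i <= X -> moddef a b i = 2 ^ i).
    { induction i; intros Hi; auto. destruct (H2 i) as [u [Hu Hu']]; [lia|].
      rewrite Nat.add_1_r in Hu'. rewrite <- Hu', Hu, IHi by lia. reflexivity. }
    now apply K.
  - intros ->. destruct (beta_exists (fun i => 2 ^ i) (S X)) as (a & b & K). exists a, b.
    rewrite !K by lia. repeat split. intros i Hi. exists (2 ^ i). rewrite !K by lia.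
    rewrite Nat.add_1_r. split; auto.
Qed.

Lemma sat_Len e E s n : satN e E (Len s n) <-> 2 ^ evalN e n <= evalN e s < 2 * 2 ^ evalN e n.
Proof.
  unfold Len, Le. cbn [sat]. split.
  - intros [p [Hp [H1 H2]]]. apply sat_Pow2 in Hp. cbn [eval] in *.
    rewrite !(evalN_tlift 1 _ e) in * by auto. cbn in *. rewrite <- Hp, Nat.add_0_r in *.
    split; [destruct H1 as [H1|H1]|]; unfold Nat.lt in *; lia.
  - intros [H1 H2]. exists (2 ^ evalN e n). rewrite sat_Pow2. cbn [eval].
    rewrite !(evalN_tlift 1 _ e) by auto. cbn in *. rewrite Nat.add_0_r in *. unfold Nat.lt.
    split; [reflexivity|split; lia].
Qed.

Lemma sat_Bit e E s i : satN e E (Bit s i) <-> Nat.testbit (evalN e s) (evalN e i) = true.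
Proof.
  unfold Bit. cbn [sat]. set (S0 := evalN e s). set (I := evalN e i).
  assert (L : forall d, evalN (scons d e) (tlift 1 i) = I) by (intros; apply evalN_tlift; auto).
  assert (L3 : forall d d' d'', evalN (scons d (scons d' (scons d'' e))) (tlift 3 s) = S0)
   by (intros; apply evalN_tlift; auto).
  rewrite Nat.testbit_true.
  assert (0 < 2 ^ I) by (apply Nat.neq_0_lt_0, Nat.pow_nonzero; lia).
  split.
  - intros [p [Hp [q [r [Hr Hs]]]]]. apply sat_Pow2 in Hp. cbn [eval] in *. rewrite L in Hp. rewrite L3 in Hs.
    change (p = 2 ^ I) in Hp. change (r < p) in Hr. change (S0 = (2 * q + 1) * p + r) in Hs. subst p. rewrite Hs.
    rewrite Nat.div_add_l by lia. rewrite (Nat.div_small r) by auto.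
    replace (2 * q + 1 + 0) with (1 + q * 2) by lia. rewrite Nat.Div0.mod_add. reflexivity.
  - intros Hb. exists (2 ^ I). rewrite sat_Pow2. cbn [eval]. rewrite L. split; [reflexivity|].
    exists (S0 / 2 ^ I / 2), (S0 mod 2 ^ I). rewrite L3.
    change (S0 mod 2 ^ I < 2 ^ I /\ S0 = (2 * (S0 / 2 ^ I / 2) + 1) * 2 ^ I + S0 mod 2 ^ I).
    split; [apply Nat.mod_upper_bound; lia|].
    pose proof (Nat.div_mod (S0 / 2 ^ I) 2 ltac:(lia)). rewrite Hb in *.
    pose proof (Nat.div_mod S0 (2 ^ I) ltac:(lia)). nia.
Qed.

(** The code of the initial segment of length [m]; the summand 2^m is the end marker of the coding
    of strings. *)
Definition restrict (s m : nat) : nat := 2 ^ m + s mod 2 ^ m.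

Lemma pow2_pos m : 0 < 2 ^ m.
Proof. apply Nat.neq_0_lt_0, Nat.pow_nonzero; lia. Qed.

Lemma restrict_bounds s m : 2 ^ m <= restrict s m < 2 * 2 ^ m.
Proof.
  unfold restrict. pose proof (pow2_pos m). pose proof (Nat.mod_upper_bound s (2 ^ m)). lia.
Qed.

Lemma testbit_restrict s m i : i < m -> Nat.testbit (restrict s m) i = Nat.testbit s i.
Proof.
  intros Hi. unfold restrict. pose proof (pow2_pos m).
  rewrite <- (Nat.mod_pow2_bits_low (2 ^ m + s mod 2 ^ m) m i Hi).
  rewrite <- (Nat.mod_pow2_bits_low s m i Hi). f_equal.
  rewrite <- (Nat.mul_1_l (2 ^ m)) at 1.
  rewrite Nat.add_comm, Nat.Div0.mod_add. apply Nat.Div0.mod_mod.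
Qed.

Lemma sat_Init_restrict e E s t m : evalN e s = restrict (evalN e t) m -> 2 ^ m <= evalN e t ->
  satN e E (Init s t).
Proof.
  intros Hs Ht. unfold Init, Le, AllLt. cbn [sat].
  assert (L2 : forall u d d', evalN (scons d (scons d' e)) (tlift 2 u) = evalN e u)
   by (intros; apply evalN_tlift; auto).
  assert (L3 : forall u d d' d'', evalN (scons d (scons d' (scons d'' e))) (tlift 3 u) = evalN e u)
   by (intros; apply evalN_tlift; auto).
  pose proof (pow2_pos m). destruct (Nat.log2_spec (evalN e t)) as [K1 K2]; [lia|].
  exists m, (Nat.log2 (evalN e t)). rewrite !sat_Len, !L2. cbn [eval scons]. rewrite Hs.
  split; [apply restrict_bounds|]. split; [rewrite Nat.pow_succ_r' in K2; lia|]. split.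
  - assert (m <= Nat.log2 (evalN e t)) by (rewrite <- (Nat.log2_pow2 m) by lia; now apply Nat.log2_le_mono).
    cbn. unfold Nat.lt. lia.
  - intros i Hi. cbn in Hi. unfold Iff. cbn [sat]. rewrite !sat_Bit, !L3, Hs. cbn [eval scons].
    rewrite testbit_restrict by exact Hi. tauto.
Qed.

(** Comprehension is immediate because every subset of [nat] is a set here. The lemma turns the
    provability hypotheses on [g] into facts about a function on [nat], and it supplies the set-free
    axioms that are later transferred to the cut. *)
Lemma NS_RCA0s A : RCA0s A -> forall e E, satN e E A.
Proof.
  intros HA e E. destruct HA; cbn -[Nat.mul Nat.add Pow2]; unfold Nat.lt; try (intros; lia).
  - intros x. exists (2 ^ x). apply sat_Pow2. reflexivity.
  - intros [H0 HS]. apply sat_inst in H0. intros d. induction d; [exact H0|].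
    specialize (HS d IHd). unfold nsubst in HS. apply sat_subst in HS.
    eapply (sat_congr NS NS_congruent); [|exact HS]. intros [|n]; simpl; [lia|reflexivity].
  - intros HAB. exists (fun x => pbool (satN (scons x e) E A)). intros d.
    rewrite pboolP, sat_shiftS. tauto.
Qed.

(** * Finite combinatorics *)

Fixpoint card (b : nat) (q : nat -> bool) : nat :=
  match b with 0 => 0 | S b => card b q + (if q b then 1 else 0) end.

Lemma card_mono b b' q : b <= b' -> card b q <= card b' q.
Proof. induction 1; simpl; lia. Qed.

Lemma card_le b q q' : (forall x, x < b -> q x = true -> q' x = true) -> card b q <= card b q'.
Proof.
  induction b; simpl; intros H; auto. specialize (IHb (fun x Hx => H x ltac:(lia))).
  pose proof (H b ltac:(lia)). destruct (q b); [rewrite H0 by auto; lia|destruct (q' b); lia].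
Qed.

Lemma card_ext b q q' : (forall x, x < b -> q x = q' x) -> card b q = card b q'.
Proof. induction b; simpl; intros H; auto. rewrite IHb, (H b) by auto. reflexivity. Qed.

Lemma card_true b : card b (fun _ => true) = b.
Proof. induction b; simpl; lia. Qed.

Lemma card_lt x b q : x < b -> q x = true -> card x q < card b q.
Proof.
  intros Hx Hq. assert (card (S x) q <= card b q) by (apply card_mono; lia). simpl in *. rewrite Hq in *. lia.
Qed.

Lemma card_eq_gap x y q : card x q = card y q -> forall z, x <= z < y -> q z = false.
Proof.
  intros H z Hz. destruct (q z) eqn:E; auto.
  pose proof (card_lt z y q ltac:(lia) E). pose proof (card_mono x z q ltac:(lia)). lia.
Qed.

Lemma card_inj q x y : q x = true -> q y = true -> card x q = card y q -> x = y.
Proof.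
  intros Hx Hy H. destruct (lt_eq_lt_dec x y) as [[L|L]|L]; auto.
  - pose proof (card_lt x y q L Hx). lia.
  - pose proof (card_lt y x q L Hy). lia.
Qed.

Lemma card_pos b q : 0 < card b q -> exists x, x < b /\ q x = true.
Proof.
  induction b; simpl; [lia|]. destruct (q b) eqn:E; [exists b; auto|].
  intros H. destruct IHb as [x [Hx Hq]]; [lia|]. exists x; auto.
Qed.

Lemma card_nth b q i : i < card b q -> exists x, x < b /\ q x = true /\ card x q = i.
Proof.
  induction b; simpl; [lia|]. intros H. destruct (le_lt_dec (card b q) i) as [Hi|Hi].
  - destruct (q b) eqn:E; [|lia]. exists b. repeat split; auto; lia.
  - destruct (IHb Hi) as [x [Hx Hq]]. exists x; split; auto.
Qed.

Definition remove1 (x : nat) (q : nat -> bool) : nat -> bool := fun y => q y && negb (x =? y).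

Lemma remove1_true x q y : remove1 x q y = true <-> q y = true /\ x <> y.
Proof. unfold remove1. rewrite andb_true_iff, negb_true_iff, Nat.eqb_neq. tauto. Qed.

Lemma card_remove1_above b x q : b <= x -> card b (remove1 x q) = card b q.
Proof.
  intros Hb. apply card_ext. intros y Hy. unfold remove1.
  replace (x =? y) with false by (symmetry; apply Nat.eqb_neq; lia). apply andb_true_r.
Qed.

Lemma card_remove1 b x q : card b q <= S (card b (remove1 x q)).
Proof.
  induction b; simpl; [lia|]. destruct (Nat.eq_dec x b) as [->|Hne].
  - rewrite card_remove1_above by auto. destruct (q b), (remove1 b q b); lia.
  - unfold remove1 at 2. apply Nat.eqb_neq in Hne. rewrite Hne, andb_true_r. destruct (q b); lia.
Qed.

Lemma card_remove1_in b x q : x < b -> q x = true -> card b q = S (card b (remove1 x q)).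
Proof.
  intros Hx Hq. apply Nat.le_antisymm; [apply card_remove1|].
  induction b; [lia|]. simpl. destruct (Nat.eq_dec x b) as [->|Hne].
  - rewrite card_remove1_above by auto. unfold remove1. rewrite Nat.eqb_refl, Hq. simpl. lia.
  - specialize (IHb ltac:(lia)). unfold remove1 at 2. apply Nat.eqb_neq in Hne. rewrite Hne, andb_true_r. destruct (q b); lia.
Qed.

Lemma injection_card (f : nat -> nat -> Prop) b y : forall q,
  (forall i, i < y -> exists v, v < b /\ q v = true /\ f i v) ->
  (forall i j v, i < y -> j < y -> f i v -> f j v -> i = j) -> y <= card b q.
Proof.
  induction y as [|y IH]; intros q Hf Hi; [lia|].
  destruct (Hf y (le_n _)) as [v [Hv [Hq Hfv]]].
  rewrite (card_remove1_in b v q Hv Hq). apply le_n_S, IH.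
  - intros i Hiy. destruct (Hf i ltac:(lia)) as [w [Hw [Hqw Hfw]]]. exists w. split; auto. split; auto.
    apply remove1_true. split; auto. intros ->. specialize (Hi i y w ltac:(lia) ltac:(lia) Hfw Hfv). lia.
  - intros i j w ? ?. apply Hi; lia.
Qed.

Definition colour_class (q : nat -> bool) (col : nat -> nat) (i : nat) : nat -> bool :=
  fun x => q x && (col x =? i).

Lemma colour_class_true q col i x : colour_class q col i x = true <-> q x = true /\ col x = i.
Proof. unfold colour_class. rewrite andb_true_iff, Nat.eqb_eq. tauto. Qed.

Lemma card_colours b q col m s :
  (forall x, x < b -> q x = true -> col x < m) ->
  (forall i, i < m -> card b (colour_class q col i) <= s) -> card b q <= m * s.
Proof.
  revert q. induction m as [|m IH]; intros q Hc Hs.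
  - destruct (card b q) eqn:E; auto. destruct (card_pos b q) as [x [Hx Hq]]; [lia|].
    specialize (Hc x Hx Hq). lia.
  - set (q1 := fun x => q x && negb (col x =? m)).
    assert (H1 : card b q1 <= m * s).
    { apply IH.
      - intros x Hx. unfold q1. rewrite andb_true_iff, negb_true_iff, Nat.eqb_neq. intros [Hq Hne].
        specialize (Hc x Hx Hq). lia.
      - intros i Hi. eapply Nat.le_trans; [|apply (Hs i); lia]. apply card_le. intros x _.
        rewrite !colour_class_true. unfold q1. rewrite andb_true_iff. tauto. }
    specialize (Hs m (le_n _)).
    assert (card b q <= card b q1 + card b (colour_class q col m)); [|lia].
    clear. induction b; simpl; auto. unfold q1 at 2, colour_class at 2.
    destruct (q b), (col b =? m); simpl; lia.
Qed.

Lemma pigeonhole b q col m :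
  0 < card b q -> (forall x, x < b -> q x = true -> col x < m) ->
  exists i, i < m /\ card b q <= m * card b (colour_class q col i).
Proof.
  intros Hp Hc. apply NNPP. intros N.
  assert (m <> 0). { destruct (card_pos _ _ Hp) as [x [Hx Hq]]. specialize (Hc x Hx Hq). lia. }
  pose proof (Nat.Div0.mul_div_le (card b q - 1) m).
  pose proof (Nat.mul_succ_div_gt (card b q - 1) m ltac:(lia)).
  (* If all classes had at most s elements, card would be at most m s <= card - 1. So some class has
     at least s + 1 elements, and m (s + 1) >= card. *)
  set (s := (card b q - 1) / m) in *.
  assert (card b q <= m * s); [|lia].
  apply (card_colours b q col m s Hc). intros i Hi.
  destruct (le_lt_dec (card b (colour_class q col i)) s); auto.
  exfalso. apply N. exists i. split; auto. nia.
Qed.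

(** * The Erdos-Szekeres argument for transitive relations *)

Definition up_transitive (r : nat -> nat -> Prop) : Prop :=
  forall x y z, x < y < z -> r x y -> r y z -> r x z.

Definition homogeneous (q : nat -> bool) (r : nat -> nat -> Prop) : Prop :=
  forall x y, q x = true -> q y = true -> x < y -> r x y.

(** [L x] plays the role of the length of a longest [r]-chain of [q] ending at [x]. *)
Lemma chain_colouring r q b : up_transitive r -> exists L : nat -> nat,
  (forall x y, x < y < b -> q x = true -> q y = true -> r x y -> L x < L y) /\
  (forall x, x < b -> q x = true -> exists q', (forall y, q' y = true -> q y = true /\ y <= x) /\
     q' x = true /\ homogeneous q' r /\ card b q' = S (L x)).
Proof.
  intros T. induction b as [|b [L [H1 H2]]].
  - exists (fun _ => 0). split; intros; lia.
  - set (P := fun l => exists y, y < b /\ q y = true /\ r y b /\ l = S (L y)).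
    assert (HL : exists l, (forall k, P k -> k <= l) /\ (l = 0 \/ P l)).
    { destruct (classic (exists l, P l)) as [Hex|Hnex].
      - assert (HB : exists B, forall y, y < b -> L y <= B).
        { clear. induction b as [|b [B HB]]; [exists 0; lia|]. exists (B + L b). intros y Hy.
          destruct (Nat.eq_dec y b) as [->|]; [lia|]. specialize (HB y ltac:(lia)). lia. }
        destruct HB as [B HB].
        destruct (ex_max P (S B) Hex) as [l [Hl Hm]]; [|exists l; auto].
        intros k [y [Hy [_ [_ ->]]]]. specialize (HB y Hy). lia.
      - exists 0. split; auto. intros k Hk. destruct Hnex; eauto. }
    destruct HL as [l [Hmax Hl]].
    exists (fun x => if x =? b then l else L x). split.
    + intros x y Hxy Hx Hy Hr. replace (x =? b) with false by (symmetry; apply Nat.eqb_neq; lia).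
      destruct (Nat.eqb_spec y b) as [->|Hne].
      * apply Hmax. exists x. repeat split; auto; lia.
      * apply H1; auto; lia.
    + intros x Hx Hq. destruct (Nat.eqb_spec x b) as [->|Hne].
      * assert (HC : exists q', (forall y, q' y = true -> q y = true /\ y < b /\ r y b) /\
            homogeneous q' r /\ card b q' = l).
        { destruct Hl as [->|[y [Hy [Hqy [Hr ->]]]]].
          - exists (fun _ => false). repeat split; try discriminate.
            clear; induction b; simpl; lia.
          - destruct (H2 y Hy Hqy) as [q' [K1 [K2 [K3 K4]]]]. exists q'. split; [|split; auto].
            intros z Hz. destruct (K1 z Hz) as [K5 K6]. split; auto. split; [lia|].
            destruct (Nat.eq_dec z y) as [->|]; auto. apply (T z y b); [lia| |auto]. apply K3; auto; lia. }
        destruct HC as [q' [K1 [K2 K3]]]. exists (fun y => q' y || (y =? b)).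
        split; [|split; [|split]].
        -- intros y. rewrite orb_true_iff, Nat.eqb_eq. intros [Hy| ->]; [|split; auto].
           destruct (K1 y Hy) as [? [? ?]]. split; auto; lia.
        -- rewrite Nat.eqb_refl. apply orb_true_r.
        -- intros y z. rewrite !orb_true_iff, !Nat.eqb_eq. intros [Hy| ->] [Hz| ->] Hyz.
           ++ apply K2; auto.
           ++ apply K1; auto.
           ++ destruct (K1 z Hz). lia.
           ++ lia.
        -- simpl. rewrite Nat.eqb_refl, orb_true_r, <- K3, Nat.add_1_r. f_equal. apply card_ext.
           intros y Hy. replace (y =? b) with false by (symmetry; apply Nat.eqb_neq; lia). apply orb_false_r.
      * destruct (H2 x ltac:(lia) Hq) as [q' [K1 [K2 [K3 K4]]]]. exists q'. repeat split; auto; try (now apply K1).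
        simpl. rewrite K4. destruct (q' b) eqn:E; [|lia]. destruct (K1 b E). lia.
Qed.

(** Points with the same value of [L] are never related, so a large colour class is homogeneous for
    the negation; if there is no large class, some value of [L] is large and yields a long chain. *)
Lemma erdos_szekeres r q b : up_transitive r -> exists q',
  (forall x, q' x = true -> q x = true) /\ card b q <= card b q' * card b q' /\
  (homogeneous q' r \/ homogeneous q' (fun x y => ~ r x y)).
Proof.
  intros T. destruct (Nat.eq_dec (card b q) 0) as [Hz|Hnz].
  { exists (fun _ => false). repeat split; try discriminate; [lia|]. left. intros x y ?; discriminate. }
  (* The colouring speaks only of points below [b], whereas homogeneity of the result is claimed
     everywhere. *)
  set (q0 := fun x => q x && (x <? b)).
  assert (H0 : forall x, q0 x = true <-> q x = true /\ x < b).
  { intros x. unfold q0. rewrite andb_true_iff, Nat.ltb_lt. tauto. }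
  assert (C0 : card b q0 = card b q).
  { apply Nat.le_antisymm; apply card_le; intros x Hx; rewrite H0; tauto. }
  destruct (chain_colouring r q0 b T) as [L [H1 H2]].
  (* The root of card - 1 gives s^2 < card <= (s + 1)^2. Either some chain has s + 1 points, or [L]
     takes only s values and one of them is taken more than s times. *)
  set (s := Nat.sqrt (card b q - 1)).
  pose proof (Nat.sqrt_spec (card b q - 1) ltac:(lia)) as [S1 S2]. fold s in S1, S2.
  destruct (classic (exists x, x < b /\ q0 x = true /\ s <= L x)) as [[x [Hx [Hq Hs]]]|N].
  - destruct (H2 x Hx Hq) as [q' [K1 [K2 [K3 K4]]]]. exists q'. split; [|split].
    + intros y Hy. apply K1 in Hy as [Hy _]. now apply H0 in Hy.
    + rewrite K4. nia.
    + now left.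
  - destruct (pigeonhole b q0 L s) as [i [Hi Hc]]; [lia| |].
    { intros x Hx Hq. destruct (le_lt_dec s (L x)); auto. exfalso; apply N; eauto. }
    rewrite C0 in Hc.
    exists (colour_class q0 L i). split; [|split].
    + intros x Hx. apply colour_class_true in Hx as [Hx _]. now apply H0 in Hx.
    + assert (s < card b (colour_class q0 L i)) by nia. nia.
    + right. intros x y Hx Hy Hxy Hr.
      apply colour_class_true in Hx as [Hx <-], Hy as [Hy Hl].
      assert (y < b) by now apply H0 in Hy.
      specialize (H1 x y ltac:(lia) Hx Hy Hr). lia.
Qed.

(** * One shrinking step *)

Definition npair (x y : nat) : nat := (x + y) * (x + y) + x.

Lemma npair_inj x y x' y' : npair x y = npair x' y' -> x = x' /\ y = y'.
Proof. unfold npair. intros H. assert (x + y = x' + y') by nia. split; nia. Qed.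

Definition trans_upto (p : nat -> bool) (m : nat) : Prop :=
  forall x y z, x <= m -> y <= m -> z <= m ->
    p (npair x y) = true -> p (npair y z) = true -> p (npair x z) = true.

(** Cutting [p] off at the first failure of transitivity makes the homogeneous set exist unconditionally. *)
Definition rel_up (p : nat -> bool) (x y : nat) : Prop := p (npair x y) = true /\ trans_upto p y.
Definition rel_down (p : nat -> bool) (x y : nat) : Prop := p (npair y x) = true /\ trans_upto p y.

(** [step_up] and [step_down] are separate because a partial order may relate a smaller number to a
    larger one or conversely. [step_gap] will force unbounded sets to have n elements below the
    stage, and [step_min] makes successive minima climb. In [step_card] the factor 4 pays for two
    square roots, the extra 3 for the pigeonhole factor and for the removal of one point. *)
Record step_spec (n b : nat) (q p q' : nat -> bool) : Prop := {
  step_sub : forall x, q' x = true -> q x = true;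
  step_up : homogeneous q' (rel_up p) \/ homogeneous q' (fun x y => ~ rel_up p x y);
  step_down : homogeneous q' (rel_down p) \/ homogeneous q' (fun x y => ~ rel_down p x y);
  step_gap : (forall x y z, q' x = true -> q' y = true -> x <= z < y -> p z = false) \/
             (forall x, q' x = true -> n <= card x p);
  step_min : exists x, q x = true /\ forall y, q' y = true -> x < y;
  step_card : forall m, 2 <= n -> n ^ (4 * (m + 3)) <= card b q -> n ^ m <= card b q' }.

Lemma step_exists n b q p : 0 < card b q -> (forall x, q x = true -> x < b) ->
  exists q', step_spec n b q p q'.
Proof.
  intros Hpos Hb.
  destruct (erdos_szekeres (rel_up p) q b) as [q1 [A1 [A2 A3]]].
  (* The cut-off at the largest point covers all three points, so [rel_up p] is transitive whatever
     [p] is. *)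
  { intros x y z Hxyz [Hp Ht] [Hp' Ht']. split; auto. apply (Ht' x y z); auto; lia. }
  destruct (erdos_szekeres (rel_down p) q1 b) as [q2 [B1 [B2 B3]]].
  { intros x y z Hxyz [Hp Ht] [Hp' Ht']. split; auto. apply (Ht' z y x); auto; lia. }
  (* Colour n means that at least n elements of [p] lie below; any smaller colour is the exact
     count, so [p] has no element between two points of that colour. *)
  set (col := fun x => Nat.min n (card x p)).
  destruct (pigeonhole b q2 col (S n)) as [i [Hi C]].
  { assert (0 < card b q1) by (destruct (card b q1); lia). destruct (card b q2); lia. }
  { intros x _ _. unfold col. lia. }
  set (q3 := colour_class q2 col i) in *.
  assert (Hne : 0 < card b q3).
  { assert (0 < card b q1) by (destruct (card b q1); lia).
    assert (0 < card b q2) by (destruct (card b q2); lia). destruct (card b q3); lia. }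
  destruct (card_pos _ _ Hne) as [x3 [_ Hx3]].
  destruct (ex_least (fun x => q3 x = true)) as [x0 [Hx0 Hmin]]; [eauto|].
  assert (sub3 : forall x, q3 x = true -> q2 x = true /\ col x = i) by (intros x; apply colour_class_true).
  (* The least point is dropped: it belongs to [q] and lies strictly below all that remains, as
     [step_min] demands. *)
  exists (remove1 x0 q3).
  assert (sub : forall x, remove1 x0 q3 x = true -> q2 x = true /\ q3 x = true).
  { intros x Hx. apply remove1_true in Hx as [Hx _]. split; [now apply sub3|auto]. }
  constructor.
  - intros x Hx. apply sub in Hx as [Hx _]. auto.
  - destruct A3 as [A3|A3]; [left|right]; intros x y Hx Hy; apply A3; apply B1; now apply sub.
  - destruct B3 as [B3|B3]; [left|right]; intros x y Hx Hy; apply B3; now apply sub.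
  - destruct (Nat.eq_dec i n) as [->|Hin].
    + right. intros x Hx. apply sub in Hx as [_ Hx]. apply sub3 in Hx as [_ Hx]. unfold col in Hx. lia.
    + left. intros x y z Hx Hy. apply card_eq_gap.
      apply sub in Hx as [_ Hx], Hy as [_ Hy]. apply sub3 in Hx as [_ Hx], Hy as [_ Hy]. unfold col in *. lia.
  - exists x0. split; [apply A1, B1; now apply sub3|]. intros y Hy. apply remove1_true in Hy as [Hy Hne'].
    destruct (le_lt_dec y x0); auto. exfalso. apply (Hmin y); auto. lia.
  - intros m Hn Hm. pose proof (card_remove1 b x0 q3) as D.
    set (u := n ^ m) in *. assert (Hu : 0 < u) by (apply Nat.neq_0_lt_0, Nat.pow_nonzero; lia).
    assert (E : n ^ (m + 3) <= card b q2).
    { assert (E1 : n ^ (4 * (m + 3)) = (n ^ (m + 3) * n ^ (m + 3)) * (n ^ (m + 3) * n ^ (m + 3))).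
      { rewrite <- !Nat.pow_add_r. f_equal. lia. }
      rewrite E1 in Hm. set (w := n ^ (m + 3)) in *.
      assert (w * w <= card b q1) by nia. nia. }
    rewrite Nat.pow_add_r in E. fold u in E. change (n ^ 3) with (n * (n * (n * 1))) in E.
    (* From n = 2 on, n^3 absorbs the factor n + 1 and leaves a factor 2, which covers the removed
       point. *)
    assert (2 * S n <= n * (n * (n * 1))) by nia.
    assert (u * (2 * S n) <= S n * card b q3) by nia.
    assert (2 * u <= card b q3) by nia. lia.
Qed.

Definition step (n b : nat) (q p : nat -> bool) : nat -> bool :=
  epsilon (inhabits (fun _ => false)) (step_spec n b q p).

Lemma step_correct n b q p : 0 < card b q -> (forall x, q x = true -> x < b) -> step_spec n b q p (step n b q p).
Proof. intros H1 H2. exact (epsilon_spec (inhabits (fun _ => false)) _ (step_exists n b q p H1 H2)). Qed.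

(** Elements [< x] of [p] are counted by [card x p], so these are the first [n] elements of [p]
    and their increasing enumeration. *)
Definition first_elements (n : nat) (p : nat -> bool) : nat -> bool :=
  fun x => pbool (p x = true /\ card x p < n).
Definition enumeration (n : nat) (p : nat -> bool) : nat -> bool :=
  fun z => pbool (exists x, z = npair (card x p) x /\ p x = true /\ card x p < n).

Lemma enumeration_true n p i x : enumeration n p (npair i x) = true <-> p x = true /\ i = card x p /\ i < n.
Proof.
  unfold enumeration. rewrite pboolP. split.
  - intros [y [H [Hp Hn]]]. apply npair_inj in H as [-> ->]. auto.
  - intros [Hp [-> Hn]]. eauto.
Qed.

(** Here [T] is an arbitrary set, as a component of a tree of the model may fail to be a tree;
    closure under initial segments is therefore asked of the string. *)
Definition good_string (T : nat -> bool) (s : nat) : Prop :=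
  0 < s /\ forall m, 2 ^ m <= s -> T (restrict s m) = true.

(** Only strings below [b] compete, so that a maximal length exists even when [T] has arbitrarily
    long good strings. *)
Definition longest_string (T : nat -> bool) (b : nat) : nat :=
  epsilon (inhabits 0) (fun s => good_string T s /\
    forall s', good_string T s' -> s' < b -> Nat.log2 s' <= Nat.log2 s).

Lemma longest_string_spec T b s : good_string T s -> s < b ->
  good_string T (longest_string T b) /\ Nat.log2 s <= Nat.log2 (longest_string T b).
Proof.
  intros Hs Hb.
  assert (H : exists s, good_string T s /\ forall s', good_string T s' -> s' < b -> Nat.log2 s' <= Nat.log2 s).
  { destruct (ex_max (fun l => exists s, good_string T s /\ s < b /\ l = Nat.log2 s) b) as [l [[s1 [G1 [G2 ->]]] M]].
    - eauto.
    - intros l [s1 [_ [H ->]]]. pose proof (Nat.log2_le_lin s1). lia.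
    - exists s1. split; auto. intros s' H1 H2. apply M. eauto. }
  destruct (epsilon_spec (inhabits 0) _ H) as [H1 H2]. split; [exact H1|apply H2; auto].
Qed.

(** * Countability of the syntax *)

Definition countable_type (X : Type) : Prop := exists f : nat -> X, forall x, exists k, f k = x.

Lemma countable_of_lists (X : Type) (d : X) (L : nat -> list X) :
  (forall x, exists n, In x (L n)) -> countable_type X.
Proof.
  intros H. exists (fun k => nth (snd (Cantor.of_nat k)) (L (fst (Cantor.of_nat k))) d).
  intros x. destruct (H x) as [n Hn]. apply (In_nth _ _ d) in Hn as [i [_ Hi]].
  exists (Cantor.to_nat (n, i)). now rewrite Cantor.cancel_of_to.
Qed.

Definition pairs {X Y : Type} (f : X -> X -> Y) (l : list X) : list Y :=
  flat_map (fun a => map (f a) l) l.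

Lemma in_pairs {X Y : Type} (f : X -> X -> Y) l a b : In a l -> In b l -> In (f a b) (pairs f l).
Proof. intros Ha Hb. apply in_flat_map. exists a. split; auto. now apply in_map. Qed.

Lemma stage_mono {X : Type} (L : nat -> list X) : (forall n, incl (L n) (L (S n))) ->
  forall n m x, n <= m -> In x (L n) -> In x (L m).
Proof. intros H n m x. induction 1; auto. intros. now apply H, IHle. Qed.

Fixpoint terms (n : nat) : list term :=
  match n with
  | 0 => []
  | S n => terms n ++ [Zero; One; Var n] ++ pairs Add (terms n) ++ pairs Mul (terms n)
  end.

Lemma terms_mono n m t : n <= m -> In t (terms n) -> In t (terms m).
Proof. apply (stage_mono terms). intros k u Hu. apply in_or_app. now left. Qed.

Lemma terms_all t : exists n, In t (terms n).
Proof.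
  induction t.
  - exists (S n). simpl. rewrite !in_app_iff. simpl. auto.
  - exists 1. simpl. auto.
  - exists 1. simpl. auto.
  - destruct IHt1 as [a Ha], IHt2 as [b Hb]. exists (S (a + b)). simpl. rewrite in_app_iff. right. do 3 right.
    apply in_app_iff. left. apply in_pairs; (eapply terms_mono; [|eassumption]; lia).
  - destruct IHt1 as [a Ha], IHt2 as [b Hb]. exists (S (a + b)). simpl. rewrite in_app_iff. right. do 3 right.
    apply in_app_iff. right. apply in_pairs; (eapply terms_mono; [|eassumption]; lia).
Qed.

Definition form_layer (n : nat) (l : list form) : list (list form) :=
  [[Bot]; pairs Eq (terms n); pairs Lt (terms n);
   flat_map (fun t => map (Mem t) (seq 0 n)) (terms n);
   pairs Imp l; pairs And l; pairs Or l; map All l; map Ex l; map AllS l; map ExS l].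

Fixpoint forms (n : nat) : list form :=
  match n with
  | 0 => []
  | S n => forms n ++ concat (form_layer n (forms n))
  end.

Lemma forms_mono n m A : n <= m -> In A (forms n) -> In A (forms m).
Proof. apply (stage_mono forms). intros k u Hu. apply in_or_app. now left. Qed.

Lemma forms_stage n l A : In l (form_layer n (forms n)) ->
  In A l -> In A (forms (S n)).
Proof. intros Hl HA. apply in_or_app. right. apply in_concat. eauto. Qed.

Lemma forms_all A : exists n, In A (forms n).
Proof.
  assert (B2 : forall f : form -> form -> form, (forall n, In (pairs f (forms n)) (form_layer n (forms n))) ->
     forall A B, (exists n, In A (forms n)) -> (exists n, In B (forms n)) -> exists n, In (f A B) (forms n)).
  { intros f Hf X Y [a Ha] [b Hb]. exists (S (a + b)). eapply forms_stage; [apply Hf|].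
    apply in_pairs; (eapply forms_mono; [|eassumption]; lia). }
  induction A.
  - exists 1. simpl. auto.
  - destruct (terms_all s) as [a Ha], (terms_all t) as [b Hb]. exists (S (a + b)).
    eapply forms_stage; [do 1 right; left; reflexivity|]. apply in_pairs; (eapply terms_mono; [|eassumption]; lia).
  - destruct (terms_all s) as [a Ha], (terms_all t) as [b Hb]. exists (S (a + b)).
    eapply forms_stage; [do 2 right; left; reflexivity|]. apply in_pairs; (eapply terms_mono; [|eassumption]; lia).
  - destruct (terms_all t) as [b Hb]. exists (S (S X + b)).
    eapply forms_stage; [do 3 right; left; reflexivity|]. apply in_flat_map. exists t.
    split; [(eapply terms_mono; [|eassumption]; lia)|]. apply in_map, in_seq. lia.
  - apply (B2 Imp); auto. intros. simpl. tauto.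
  - apply (B2 And); auto. intros. simpl. tauto.
  - apply (B2 Or); auto. intros. simpl. tauto.
  - destruct IHA as [n Hn]. exists (S n). eapply forms_stage; [do 7 right; left; reflexivity|]. now apply in_map.
  - destruct IHA as [n Hn]. exists (S n). eapply forms_stage; [do 8 right; left; reflexivity|]. now apply in_map.
  - destruct IHA as [n Hn]. exists (S n). eapply forms_stage; [do 9 right; left; reflexivity|]. now apply in_map.
  - destruct IHA as [n Hn]. exists (S n). eapply forms_stage; [do 10 right; left; reflexivity|]. now apply in_map.
Qed.

(** Names for the internal objects: a code denotes a sequence, indexed by [n], of a number and a set;
    [Nil] and [Cons] build argument lists, and an operation takes a list of numbers and a list of sets. *)
Inductive op : Type :=
| OSkolem (A : form) | OId | OComp (A B : form) | OStart | OStep | OFirst | OGraph | OPath.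

Inductive code : Type := Nil | Cons (a b : code) | Op (o : op) (a b : code).

Fixpoint codes (n : nat) : list code :=
  match n with
  | 0 => []
  | S n => codes n ++ [Nil] ++ pairs Cons (codes n) ++
      flat_map (fun o => pairs (Op o) (codes n))
        (map OSkolem (forms n) ++ pairs OComp (forms n) ++ [OId; OStart; OStep; OFirst; OGraph; OPath])
  end.

Lemma codes_mono n m c : n <= m -> In c (codes n) -> In c (codes m).
Proof. apply (stage_mono codes). intros k u Hu. apply in_or_app. now left. Qed.

Lemma code_countable : countable_type code.
Proof.
  apply (countable_of_lists _ Nil codes). intros c. induction c.
  - exists 1. simpl. auto.
  - destruct IHc1 as [a Ha], IHc2 as [b Hb]. exists (S (a + b)). simpl.
    rewrite in_app_iff. right. right. rewrite in_app_iff. left. apply in_pairs; (eapply codes_mono; [|eassumption]; lia).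
  - destruct IHc1 as [a Ha], IHc2 as [b Hb].
    assert (H : exists k, forall m, k <= m -> In o (map OSkolem (forms m) ++ pairs OComp (forms m) ++
        [OId; OStart; OStep; OFirst; OGraph; OPath])).
    { destruct o; try (exists 0; intros m _; rewrite !in_app_iff; simpl; tauto).
      - destruct (forms_all A) as [k Hk]. exists k. intros m Hm. rewrite in_app_iff. left.
        apply in_map. eapply forms_mono; [|eassumption]; lia.
      - destruct (forms_all A) as [k Hk], (forms_all B) as [k' Hk']. exists (k + k'). intros m Hm.
        rewrite !in_app_iff. right; left. apply in_pairs; (eapply forms_mono; [|eassumption]; lia). }
    destruct H as [k Hk]. exists (S (a + b + k)). simpl.
    rewrite in_app_iff. right. right. rewrite in_app_iff. right. apply in_flat_map. exists o.
    split; [apply Hk; lia|]. apply in_pairs; (eapply codes_mono; [|eassumption]; lia).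
Qed.

(** * A function dominating the least witnesses of all arithmetical formulas *)

Lemma collect (Q : nat -> nat -> Prop) N :
  (forall v, exists b, Q v b) -> (forall v b b', b <= b' -> Q v b -> Q v b') ->
  exists b, forall v, v <= N -> Q v b.
Proof.
  intros He Hm. induction N as [|N [b Hb]].
  - destruct (He 0) as [b Hb]. exists b. intros v Hv. now replace v with 0 by lia.
  - destruct (He (S N)) as [c Hc]. exists (b + c). intros v Hv.
    destruct (Nat.eq_dec v (S N)) as [->|].
    + apply (Hm _ c); auto; lia.
    + apply (Hm _ b); [lia|]. apply Hb. lia.
Qed.

(** Only [k] entries of an environment matter to [P], and with entries at most [N] they form
    finitely many tuples; the induction on [k] treats one coordinate at a time. *)
Lemma witness_bound k N : forall P : (nat -> nat) -> nat -> Prop,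
  (forall e e' y, (forall i, i < k -> e i = e' i) -> P e y -> P e' y) ->
  exists b, forall e, (forall i, i < k -> e i <= N) -> (exists y, P e y) -> exists y, y <= b /\ P e y.
Proof.
  induction k as [|k IH]; intros P HP.
  - destruct (classic (exists e y, P e y)) as [[e [y H]]|H].
    + exists y. intros e' _ _. exists y. split; auto. apply (HP e); auto. intros; lia.
    + exists 0. intros e _ [y Hy]. destruct H; eauto.
  - destruct (collect (fun v b => forall e, (forall i, i < k -> e i <= N) ->
       (exists y, P (scons v e) y) -> exists y, y <= b /\ P (scons v e) y) N) as [b Hb].
    + intros v. apply (IH (fun e => P (scons v e))). intros e e' y He. apply HP.
      intros [|i] Hi; simpl; auto. apply He. lia.
    + intros v b b' Hbb H e He Hy. destruct (H e He Hy) as [y [? ?]]. exists y. split; auto. lia.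
    + exists b. intros e He [y Hy].
      assert (S1 : forall i, scons (e 0) (fun i => e (S i)) i = e i) by (intros [|i]; reflexivity).
      destruct (Hb (e 0) (He 0 ltac:(lia)) (fun i => e (S i))) as [z [Hz Pz]].
      * intros i Hi. apply He. lia.
      * exists y. eapply HP; [|exact Hy]. intros; now rewrite S1.
      * exists z. split; auto. eapply HP; [|exact Pz]. intros; now rewrite S1.
Qed.

Definition no_sets : nat -> nat -> bool := fun _ _ => false.

(** A single function serves all formulas only from a threshold [N0] that depends on the formula.
    Modulo the ultrafilter this is harmless, since [h] will be applied to bounds that majorize n. *)
Definition dominates (h : nat -> nat) : Prop := forall A k, set_free A -> below (S k) A ->
  exists N0, forall N, N0 <= N -> forall e E, (forall i, i < k -> e i <= N) ->
    (exists y, satN (scons y e) E A) -> exists y, y <= h N /\ satN (scons y e) E A.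

Lemma dominating_function : exists h : nat -> nat,
  (forall x y, x <= y -> h x <= h y) /\ (forall x, (x + 1) * (x + 1) <= h x) /\ dominates h.
Proof.
  destruct (countable_of_lists form Bot forms forms_all) as [fm Hfm].
  set (Q := fun N i b => forall k, k <= N -> set_free (fm i) -> below (S k) (fm i) ->
    forall e, (forall i, i < k -> e i <= N) ->
    (exists y, satN (scons y e) no_sets (fm i)) -> exists y, y <= b /\ satN (scons y e) no_sets (fm i)).
  (* Diagonalization: the value at [N] takes care of the formulas numbered up to [N], with at most
     [N] parameters, all bounded by [N]. *)
  assert (HQ : forall N, exists b, forall i, i <= N -> Q N i b).
  { intros N. apply collect.
    - intros i.
      destruct (collect (fun k b => set_free (fm i) -> below (S k) (fm i) ->
        forall e, (forall i, i < k -> e i <= N) ->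
        (exists y, satN (scons y e) no_sets (fm i)) -> exists y, y <= b /\ satN (scons y e) no_sets (fm i)) N) as [b Hb].
      + intros k. destruct (classic (set_free (fm i) /\ below (S k) (fm i))) as [[F Bl]|Hn].
        * destruct (witness_bound k N (fun e y => satN (scons y e) no_sets (fm i))) as [b Hb].
          { intros e e' y He. apply (sat_local NS (fm i) (S k) Bl F). intros [|j] Hj; simpl; auto. symmetry; apply He; lia. }
          exists b. intros _ _. exact Hb.
        * exists 0. tauto.
      + intros k b b' Hbb H F Bl e He Hy. destruct (H F Bl e He Hy) as [y [? ?]]. exists y; split; auto; lia.
      + exists b. exact Hb.
    - intros i b b' Hbb H k Hk F Bl e He Hy. destruct (H k Hk F Bl e He Hy) as [y [? ?]]. exists y; split; auto; lia. }
  destruct (choice _ HQ) as [hb Hhb].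
  set (sum := fix sum N := match N with 0 => hb 0 | S N => sum N + hb (S N) end).
  assert (sum_ge : forall N, hb N <= sum N) by (intros [|N]; simpl; lia).
  assert (sum_mono : forall x y, x <= y -> sum x <= sum y) by (induction 1; simpl; lia).
  (* Partial sums make the function monotone; the square puts sums and products below one
     application of [h]. *)
  exists (fun N => sum N + (N + 1) * (N + 1)). split; [|split].
  - intros x y Hxy. specialize (sum_mono x y Hxy). nia.
  - intros x. lia.
  - intros A k F Bl. destruct (Hfm A) as [i <-]. exists (i + k). intros N HN e E He [y Hy].
    destruct (Hhb N i ltac:(lia) k ltac:(lia) F Bl e He) as [z [Hz Sz]].
    + exists y. eapply (sat_local NS (fm i) (S k) Bl F); [|exact Hy]. auto.
    + exists z. split; [specialize (sum_ge N); lia|].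
      eapply (sat_local NS (fm i) (S k) Bl F); [|exact Sz]. auto.
Qed.

(** * The cut *)

Lemma square_bounds x y : x + y <= (Nat.max x y + 1) * (Nat.max x y + 1) /\
  x * y <= (Nat.max x y + 1) * (Nat.max x y + 1).
Proof.
  pose proof (Nat.le_max_l x y). pose proof (Nat.le_max_r x y). set (m := Nat.max x y) in *. split; nia.
Qed.

Section Cut.

Variable U : (nat -> Prop) -> Prop.
Hypothesis U_mono : forall P Q, U P -> (forall n, P n -> Q n) -> U Q.
Hypothesis U_and : forall P Q, U P -> U Q -> U (fun n => P n /\ Q n).
Hypothesis U_or : forall P, U P \/ U (fun n => ~ P n).
Hypothesis U_ne : ~ U (fun _ => False).
Hypothesis U_ge : forall k, U (fun n => k <= n).

Variables G h : nat -> nat.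
Hypothesis G_grows : forall k, exists N, forall n, N <= n -> n ^ k <= G n.
Hypothesis h_mono : forall x y, x <= y -> h x <= h y.
Hypothesis h_sq : forall x, (x + 1) * (x + 1) <= h x.
Hypothesis h_dom : dominates h.
Variable en : nat -> code.
Hypothesis en_surj : forall c, exists k, en k = c.

(** * The ultrafilter commutes with the connectives *)

Lemma U_2 (P Q R : nat -> Prop) : U P -> U Q -> (forall n, P n -> Q n -> R n) -> U R.
Proof. intros HP HQ H. apply (U_mono _ _ (U_and _ _ HP HQ)). intros n []; auto. Qed.

Lemma U_3 (P Q R S : nat -> Prop) : U P -> U Q -> U R -> (forall n, P n -> Q n -> R n -> S n) -> U S.
Proof. intros HP HQ HR H. apply (U_2 _ _ _ (U_and _ _ HP HQ) HR). intros n []; auto. Qed.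

Lemma U_all (P : nat -> Prop) : (forall n, P n) -> U P.
Proof. intros H. apply (U_mono _ _ (U_ge 0)). auto. Qed.

Lemma U_not (P : nat -> Prop) : U (fun n => ~ P n) <-> ~ U P.
Proof.
  split.
  - intros H1 H2. apply U_ne, (U_2 _ _ _ H1 H2). auto.
  - intros H. destruct (U_or P); tauto.
Qed.

Lemma U_absurd (P : nat -> Prop) : U P -> U (fun n => ~ P n) -> False.
Proof. intros H1 H2. now apply U_not in H2. Qed.

Lemma U_ex (P : nat -> Prop) : U P -> exists n, P n.
Proof. intros H. apply NNPP. intros N. apply U_ne, (U_mono _ _ H). eauto. Qed.

Lemma U_disj (P Q : nat -> Prop) : U (fun n => P n \/ Q n) <-> U P \/ U Q.
Proof.
  split.
  - intros H. destruct (U_or P) as [HP|HP]; auto. right. apply (U_2 _ _ _ H HP). tauto.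
  - intros [H|H]; apply (U_mono _ _ H); auto.
Qed.

Lemma U_conj (P Q : nat -> Prop) : U (fun n => P n /\ Q n) <-> U P /\ U Q.
Proof. split; [intros H; split; apply (U_mono _ _ H); tauto|intros []; auto]. Qed.

Lemma U_imp (P Q : nat -> Prop) : U (fun n => P n -> Q n) <-> (U P -> U Q).
Proof.
  split.
  - intros H HP. apply (U_2 _ _ _ H HP). auto.
  - intros H. destruct (U_or P) as [HP|HP]; [apply (U_mono _ _ (H HP))|apply (U_mono _ _ HP)]; tauto.
Qed.

Lemma U_large (P : nat -> Prop) : (exists N, forall n, N <= n -> P n) -> U P.
Proof. intros [N H]. apply (U_mono _ _ (U_ge N) H). Qed.

(** * Values of names *)

(** The first iterate beyond the starting set, so counting below it counts a whole stage; it also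
    exceeds the cut. *)
Definition bnd (n : nat) : nat := Nat.iter (G n) h n.

Definition obj : Type := (nat * (nat -> bool))%type.
Definition dflt : obj := (0, fun _ => false).
Definition nums (l : list obj) (i : nat) : nat := fst (nth i l dflt).
Definition setsof (l : list obj) (i : nat) : nat -> bool := snd (nth i l dflt).

(** Each operation is computed on standard numbers and sets, separately for each n, so it is total
    and its result belongs to the model without any appeal to comprehension there. *)
Definition apply_op (n : nat) (o : op) (l l' : list obj) : obj :=
  let e := nums l in let E := setsof l' in
  match o with
  | OSkolem A => (least (fun y => satN (scons y e) E A), fun _ => false)
  | OId => (n, fun _ => false)
  | OComp A B => (0, fun x => pbool (exists w,
      satN (scons w (scons x e)) E A /\ ~ satN (scons w (scons x e)) E B))
  | OStart => (0, fun x => pbool (exists j, j < G n /\ x = Nat.iter j h n))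
  | OStep => (0, step n (bnd n) (E 0) (E 1))
  | OFirst => (0, first_elements n (E 0))
  | OGraph => (0, enumeration n (E 0))
  | OPath => (0, Nat.testbit (longest_string (E 0) (bnd n)))
  end.

Fixpoint denote (n : nat) (c : code) : obj * list obj :=
  match c with
  | Nil => (dflt, [])
  | Cons a b => (dflt, fst (denote n a) :: snd (denote n b))
  | Op o a b => (apply_op n o (snd (denote n a)) (snd (denote n b)), [])
  end.

Definition nm (c : code) (n : nat) : nat := fst (fst (denote n c)).
Definition st (c : code) (n : nat) : nat -> bool := snd (fst (denote n c)).

Fixpoint tuple (f : nat -> code) (k : nat) : code :=
  match k with 0 => Nil | S k => Cons (f 0) (tuple (fun i => f (S i)) k) end.

Lemma denote_tuple n k : forall f i, i < k -> nth i (snd (denote n (tuple f k))) dflt = fst (denote n (f i)).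
Proof.
  induction k; intros f i Hi; [lia|]. destruct i; simpl; auto. now rewrite IHk by lia.
Qed.

Notation nmE e n := (fun i => nm (e i) n).
Notation stE E n := (fun i => st (E i) n).

(** One name serves all n at once because least witnesses are taken pointwise. Minimality is what
    later places the named number inside the cut. *)
Lemma skolem_code A (e E : nat -> code) : exists w, forall n y,
  satN (scons y (nmE e n)) (stE E n) A ->
  satN (scons (nm w n) (nmE e n)) (stE E n) A /\ nm w n <= y.
Proof.
  destruct (sat_finite_support NS A) as [k Hk].
  exists (Op (OSkolem A) (tuple e k) (tuple E k)). intros n y Hy.
  assert (H : forall y, satN (scons y (nmE e n)) (stE E n) A <->
     satN (scons y (nums (snd (denote n (tuple e k))))) (setsof (snd (denote n (tuple E k)))) A).
  { intros z. apply Hk.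
    - intros [|i] Hi; simpl; auto. unfold nums. now rewrite denote_tuple by lia.
    - intros i Hi. unfold setsof. now rewrite denote_tuple by lia. }
  rewrite H in *. unfold nm. simpl. split.
  - apply (least_spec (fun y => satN (scons y (nums (snd (denote n (tuple e k))))) (setsof (snd (denote n (tuple E k)))) A)). eauto.
  - now apply least_le.
Qed.

Lemma comp_code A B (e E : nat -> code) : exists Z, forall n x, st Z n x = true <->
  exists w, satN (scons w (scons x (nmE e n))) (stE E n) A /\ ~ satN (scons w (scons x (nmE e n))) (stE E n) B.
Proof.
  destruct (sat_finite_support NS A) as [k Hk], (sat_finite_support NS B) as [k' Hk'].
  exists (Op (OComp A B) (tuple e (k + k')) (tuple E (k + k'))). intros n x. unfold st. simpl. rewrite pboolP.
  assert (H1 : forall w i, i < k + k' -> scons w (scons x (nmE e n)) i =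
     scons w (scons x (nums (snd (denote n (tuple e (k + k')))))) i).
  { intros w [|[|i]] Hi; simpl; auto. unfold nums. now rewrite denote_tuple by lia. }
  assert (H2 : forall i, i < k + k' -> stE E n i = setsof (snd (denote n (tuple E (k + k')))) i).
  { intros i Hi. unfold setsof. now rewrite denote_tuple by lia. }
  assert (HA : forall w, satN (scons w (scons x (nmE e n))) (stE E n) A <->
     satN (scons w (scons x (nums (snd (denote n (tuple e (k + k'))))))) (setsof (snd (denote n (tuple E (k + k'))))) A).
  { intros w. apply Hk; intros; [apply H1|apply H2]; lia. }
  assert (HB : forall w, satN (scons w (scons x (nmE e n))) (stE E n) B <->
     satN (scons w (scons x (nums (snd (denote n (tuple e (k + k'))))))) (setsof (snd (denote n (tuple E (k + k'))))) B).
  { intros w. apply Hk'; intros; [apply H1|apply H2]; lia. }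
  split; intros [w Hw]; exists w; specialize (HA w); specialize (HB w); tauto.
Qed.

(** * The decreasing stages and their minima *)

(** The recursion produces names, so every stage is itself a set of the model; the set [en k] is
    treated on the way to stage [S k]. *)
Fixpoint stage (k : nat) : code :=
  match k with
  | 0 => Op OStart Nil Nil
  | S k => Op OStep Nil (Cons (stage k) (Cons (en k) Nil))
  end.

Definition least_code (c : code) : code := Op (OSkolem (Mem (Var 0) 0)) Nil (Cons c Nil).
Definition mc (k : nat) : code := least_code (stage k).

Lemma iter_h_lt j n : Nat.iter j h n < h (Nat.iter j h n).
Proof. pose proof (h_sq (Nat.iter j h n)). lia. Qed.

Lemma iter_h_mono j j' n : j <= j' -> Nat.iter j h n <= Nat.iter j' h n.
Proof.
  induction 1; auto. simpl. pose proof (iter_h_lt m n). lia.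
Qed.

Lemma iter_h_lt_inv j j' n : Nat.iter j h n < Nat.iter j' h n -> h (Nat.iter j h n) <= Nat.iter j' h n.
Proof.
  intros H. assert (j < j').
  { destruct (le_lt_dec j' j) as [L|L]; auto. pose proof (iter_h_mono j' j n L). lia. }
  change (h (Nat.iter j h n)) with (Nat.iter (S j) h n). now apply iter_h_mono.
Qed.

Lemma stage_0 n x : st (stage 0) n x = true <-> exists j, j < G n /\ x = Nat.iter j h n.
Proof. unfold st. simpl. apply pboolP. Qed.

(** All exponents must be carried together: exponent m at the next stage uses exponent 4 (m + 3) at
    the present one. Exponent 0 says that the stage is nonempty. *)
Lemma stage_large k :
  (forall m, exists N, forall n, N <= n -> n ^ m <= card (bnd n) (st (stage k) n)) /\
  (exists N, forall n, N <= n -> forall x, st (stage k) n x = true -> x < bnd n).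
Proof.
  assert (iter_lt : forall n j, j < G n -> Nat.iter j h n < bnd n).
  { intros n j Hj. unfold bnd. pose proof (iter_h_lt j n).
    pose proof (iter_h_mono (S j) (G n) n ltac:(lia)). simpl in *. lia. }
  induction k as [|k [IH1 IH2]].
  - split.
    + intros m. destruct (G_grows m) as [N HN]. exists N. intros n Hn.
      apply (Nat.le_trans _ (G n)); auto.
      apply (injection_card (fun j x => x = Nat.iter j h n)).
      * intros j Hj. exists (Nat.iter j h n). split; [auto|]. split; auto. apply stage_0. eauto.
      * intros i j v _ _ -> H. destruct (lt_eq_lt_dec i j) as [[L|L]|L]; auto.
        -- pose proof (iter_h_mono (S i) j n L). pose proof (iter_h_lt i n). simpl in *. lia.
        -- pose proof (iter_h_mono (S j) i n L). pose proof (iter_h_lt j n). simpl in *. lia.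
    + exists 0. intros n _ x Hx. apply stage_0 in Hx as [j [Hj ->]]. auto.
  - destruct (IH1 0) as [N0 H0], IH2 as [N2 H2].
    assert (SP : forall n, N0 + N2 <= n -> step_spec n (bnd n) (st (stage k) n) (st (en k) n) (st (stage (S k)) n)).
    { intros n Hn. apply step_correct.
      - specialize (H0 n ltac:(lia)). simpl in H0. lia.
      - apply H2. lia. }
    split.
    + intros m. destruct (IH1 (4 * (m + 3))) as [N1 H1]. exists (2 + N0 + N1 + N2). intros n Hn.
      apply (step_card _ _ _ _ _ (SP n ltac:(lia))); [lia|]. apply H1. lia.
    + exists (N0 + N2). intros n Hn x Hx. apply H2; [lia|]. now apply (step_sub _ _ _ _ _ (SP n Hn)).
Qed.

Lemma stage_step k : U (fun n => step_spec n (bnd n) (st (stage k) n) (st (en k) n) (st (stage (S k)) n)).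
Proof.
  destruct (stage_large k) as [H1 [N2 H2]]. destruct (H1 0) as [N0 H0].
  apply U_large. exists (N0 + N2). intros n Hn. apply step_correct.
  - specialize (H0 n ltac:(lia)). simpl in H0. lia.
  - apply H2. lia.
Qed.

Lemma stage_sub j k : j <= k -> U (fun n => forall x, st (stage k) n x = true -> st (stage j) n x = true).
Proof.
  induction 1.
  - apply U_all. auto.
  - apply (U_2 _ _ _ IHle (stage_step m)). intros n H1 H2 x Hx. apply H1, (step_sub _ _ _ _ _ H2), Hx.
Qed.

Lemma stage_bnd k : U (fun n => forall x, st (stage k) n x = true -> x < bnd n).
Proof. apply U_large, stage_large. Qed.

Lemma mc_least k : U (fun n => st (stage k) n (nm (mc k) n) = true /\
  forall x, st (stage k) n x = true -> nm (mc k) n <= x).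
Proof.
  destruct (stage_large k) as [H1 _]. destruct (H1 0) as [N0 H0].
  apply U_large. exists N0. intros n Hn. specialize (H0 n Hn). simpl in H0.
  destruct (card_pos _ _ H0) as [x [_ Hx]]. unfold nm. simpl.
  split.
  - apply (least_spec (fun y => st (stage k) n y = true)). eauto.
  - intros y Hy. now apply least_le.
Qed.

Lemma mc_ge k : U (fun n => n <= nm (mc k) n).
Proof.
  apply (U_2 _ _ _ (mc_least k) (stage_sub 0 k (Nat.le_0_l k))). intros n [H _] H2.
  apply H2, stage_0 in H as [j [_ ->]]. apply (iter_h_mono 0 j n). lia.
Qed.

(** By [step_min] an element of stage k lies strictly below the next minimum. Both are iterates of
    [h], so at least one application of [h] separates them. *)
Lemma mc_succ k : U (fun n => h (nm (mc k) n) <= nm (mc (S k)) n).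
Proof.
  apply (U_3 _ _ _ _ (mc_least k) (mc_least (S k)) (U_and _ _ (stage_step k)
    (U_and _ _ (stage_sub 0 k (Nat.le_0_l _)) (stage_sub 0 (S k) (Nat.le_0_l _))))).
  intros n [_ A2] [B1 _] [C1 [C2 C3]].
  destruct (step_min _ _ _ _ _ C1) as [x [Hx Hx']].
  apply (Nat.le_trans _ (h x)); [apply h_mono, A2, Hx|].
  specialize (Hx' _ B1). apply C2, stage_0 in Hx as [j [_ ->]].
  apply C3, stage_0 in B1 as [j' [_ Hj]]. rewrite Hj in *. now apply iter_h_lt_inv.
Qed.

Lemma mc_mono j k : j <= k -> U (fun n => nm (mc j) n <= nm (mc k) n).
Proof.
  induction 1.
  - apply U_all. auto.
  - apply (U_2 _ _ _ IHle (mc_succ m)). intros n H1 H2. pose proof (h_sq (nm (mc m) n)). lia.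
Qed.

(** * The cut as a structure *)

Definition in_cut (c : code) : Prop := exists k, U (fun n => nm c n <= nm (mc k) n).
Definition cut : Type := {c : code | in_cut c}.
Definition cnm (d : cut) : nat -> nat := nm (proj1_sig d).

Definition mc_cut (k : nat) : cut := exist _ (mc k) (ex_intro _ k (U_all _ (fun n => le_n _))).

Lemma cut_bound (d : cut) : exists k, U (fun n => cnm d n <= nm (mc k) n).
Proof. destruct d as [c H]. exact H. Qed.

Lemma in_cut_le c (d : cut) : U (fun n => nm c n <= cnm d n) -> in_cut c.
Proof.
  intros H. destruct (cut_bound d) as [k Hk]. exists k. apply (U_2 _ _ _ H Hk). intros; lia.
Qed.

Lemma cut_h (d : cut) : exists d' : cut, U (fun n => h (cnm d n) <= cnm d' n).
Proof.
  destruct (cut_bound d) as [k Hk]. exists (mc_cut (S k)).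
  apply (U_2 _ _ _ Hk (mc_succ k)). intros n H1 H2. exact (Nat.le_trans _ _ _ (h_mono _ _ H1) H2).
Qed.

(** The bound also majorizes n, which carries it past the threshold in [dominates]. *)
Lemma cut_bound_env (e : nat -> cut) k : exists d : cut, U (fun n => n <= cnm d n /\ forall i, i < k -> cnm (e i) n <= cnm d n).
Proof.
  assert (H : exists K, U (fun n => n <= nm (mc K) n /\ forall i, i < k -> cnm (e i) n <= nm (mc K) n)).
  { induction k as [|k [K IH]].
    - exists 0. apply (U_mono _ _ (mc_ge 0)). intros; split; auto; lia.
    - destruct (cut_bound (e k)) as [K' HK']. exists (K + K').
      apply (U_3 _ _ _ _ IH HK' (U_and _ _ (mc_mono K (K + K') ltac:(lia)) (mc_mono K' (K + K') ltac:(lia)))).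
      intros n [A1 A2] B1 [C1 C2]. split; [lia|]. intros i Hi.
      destruct (Nat.eq_dec i k) as [->|]; [lia|]. specialize (A2 i ltac:(lia)). lia. }
  destruct H as [K HK]. exists (mc_cut K). exact HK.
Qed.

Definition zero_code : code := Op (OSkolem (Eq (Var 0) Zero)) Nil Nil.
Definition one_code : code := Op (OSkolem (Eq (Var 0) One)) Nil Nil.
Definition add_code (a b : code) : code := Op (OSkolem (Eq (Var 0) (Add (Var 1) (Var 2)))) (Cons a (Cons b Nil)) Nil.
Definition mul_code (a b : code) : code := Op (OSkolem (Eq (Var 0) (Mul (Var 1) (Var 2)))) (Cons a (Cons b Nil)) Nil.
Definition id_code : code := Op OId Nil Nil.

Lemma nm_zero n : nm zero_code n = 0.
Proof. exact (least_eq 0). Qed.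
Lemma nm_one n : nm one_code n = 1.
Proof. exact (least_eq 1). Qed.
Lemma nm_add a b n : nm (add_code a b) n = nm a n + nm b n.
Proof. exact (least_eq (nm a n + nm b n)). Qed.
Lemma nm_mul a b n : nm (mul_code a b) n = nm a n * nm b n.
Proof. exact (least_eq (nm a n * nm b n)). Qed.

Lemma in_cut_square c (a b : cut) :
  (forall n, nm c n <= (Nat.max (cnm a n) (cnm b n) + 1) * (Nat.max (cnm a n) (cnm b n) + 1)) -> in_cut c.
Proof.
  intros H. destruct (cut_bound_env (scons a (fun _ => b)) 2) as [d Hd].
  destruct (cut_h d) as [d' Hd']. apply (in_cut_le c d'). apply (U_2 _ _ _ Hd Hd').
  intros n [_ H1] H2. pose proof (H1 0 ltac:(lia)). pose proof (H1 1 ltac:(lia)). simpl in *.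
  specialize (H n). pose proof (h_sq (cnm d n)).
  set (m := Nat.max (cnm a n) (cnm b n)) in *. assert (m <= cnm d n) by (unfold m; lia). nia.
Qed.

Lemma in_cut_zero : in_cut zero_code.
Proof. apply (in_cut_square _ (mc_cut 0) (mc_cut 0)). intros n. rewrite nm_zero. apply Nat.le_0_l. Qed.
Lemma in_cut_one : in_cut one_code.
Proof. apply (in_cut_square _ (mc_cut 0) (mc_cut 0)). intros n. rewrite nm_one. nia. Qed.
Lemma in_cut_add (a b : cut) : in_cut (add_code (proj1_sig a) (proj1_sig b)).
Proof. apply (in_cut_square _ a b). intros n. rewrite nm_add. apply square_bounds. Qed.
Lemma in_cut_mul (a b : cut) : in_cut (mul_code (proj1_sig a) (proj1_sig b)).
Proof. apply (in_cut_square _ a b). intros n. rewrite nm_mul. apply square_bounds. Qed.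
Lemma in_cut_id : in_cut id_code.
Proof. exists 0. apply (U_mono _ _ (mc_ge 0)). auto. Qed.

Definition id_cut : cut := exist _ id_code in_cut_id.

(** Every name counts as a set and acts through its trace on the cut; hence every set of the model
    is some [en k] and has been treated at a stage. *)
Definition MM : structure := {|
  dom := cut; sets := code;
  zero := exist _ zero_code in_cut_zero;
  one := exist _ one_code in_cut_one;
  add := fun a b => exist _ _ (in_cut_add a b);
  mul := fun a b => exist _ _ (in_cut_mul a b);
  eqv := fun a b => U (fun n => cnm a n = cnm b n);
  lt := fun a b => U (fun n => cnm a n < cnm b n);
  mem := fun a X => U (fun n => st X n (cnm a n) = true) |}.

Notation satM := (sat MM).
Notation evalM := (eval MM).

Lemma MM_congruent : congruent MM.
Proof.
  constructor; simpl; intros.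
  - now apply U_all.
  - apply (U_mono _ _ H). auto.
  - apply (U_2 _ _ _ H H0). congruence.
  - apply (U_2 _ _ _ H H0). unfold cnm; simpl. intros. rewrite !nm_add. unfold cnm in *. congruence.
  - apply (U_2 _ _ _ H H0). unfold cnm; simpl. intros. rewrite !nm_mul. unfold cnm in *. congruence.
  - apply (U_3 _ _ _ _ H H0 H1). intros; congruence.
  - apply (U_2 _ _ _ H H0). intros; congruence.
Qed.

(** * Los's theorem *)

Notation eN e n := (fun i => cnm (e i) n).
Notation EN E n := (fun i => st (E i) n).

Definition pointwise (e : nat -> cut) (E : nat -> code) (A : form) : Prop :=
  U (fun n => satN (eN e n) (EN E n) A).

(** The theorem of Los concerns the full ultrapower, whereas number quantifiers range over the cut
    here. Agreement therefore requires that witnesses can be bounded inside the cut, and is proved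
    for classes of formulas where this is so. *)
Definition absolute (A : form) : Prop := forall e E, satM e E A <-> pointwise e E A.

Lemma cnm_eval e t n : cnm (evalM e t) n = evalN (eN e n) t.
Proof.
  induction t; unfold cnm in *; simpl.
  - reflexivity.
  - apply nm_zero.
  - apply nm_one.
  - rewrite nm_add. now f_equal.
  - rewrite nm_mul. now f_equal.
Qed.

Lemma scons_eN d e n : eN (scons d e) n = scons (cnm d n) (eN e n).
Proof. extensionality i. now destruct i. Qed.

Lemma witness_in_cut A e E (d : cut) :
  U (fun n => exists y, y <= cnm d n /\ satN (scons y (eN e n)) (EN E n) A) ->
  exists w : cut, pointwise (scons w e) E A.
Proof.
  intros H. destruct (skolem_code A (fun i => proj1_sig (e i)) E) as [w Hw].
  assert (Hin : in_cut w).
  { apply (in_cut_le w d). apply (U_mono _ _ H). intros n [y [Hy Sy]]. destruct (Hw n y Sy). lia. }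
  exists (exist _ w Hin). unfold pointwise. apply (U_mono _ _ H). intros n [y [Hy Sy]].
  rewrite scons_eN. exact (proj1 (Hw n y Sy)).
Qed.

Lemma absolute_imp A B : absolute A -> absolute B -> absolute (Imp A B).
Proof. intros HA HB e E. unfold pointwise. simpl. rewrite U_imp, (HA e E), (HB e E). tauto. Qed.
Lemma absolute_and A B : absolute A -> absolute B -> absolute (And A B).
Proof. intros HA HB e E. unfold pointwise. simpl. rewrite U_conj, (HA e E), (HB e E). tauto. Qed.
Lemma absolute_or A B : absolute A -> absolute B -> absolute (Or A B).
Proof. intros HA HB e E. unfold pointwise. simpl. rewrite U_disj, (HA e E), (HB e E). tauto. Qed.
Lemma absolute_bot : absolute Bot.
Proof. intros e E. unfold pointwise. simpl. tauto. Qed.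
Lemma absolute_eq s t : absolute (Eq s t).
Proof.
  intros e E. unfold pointwise. simpl. split; intros H; apply (U_mono _ _ H); intros n; now rewrite !cnm_eval.
Qed.
Lemma absolute_lt s t : absolute (Lt s t).
Proof.
  intros e E. unfold pointwise. simpl. split; intros H; apply (U_mono _ _ H); intros n; now rewrite !cnm_eval.
Qed.
Lemma absolute_mem t X : absolute (Mem t X).
Proof.
  intros e E. unfold pointwise. simpl. split; intros H; apply (U_mono _ _ H); intros n; now rewrite !cnm_eval.
Qed.
Lemma absolute_neg A : absolute A -> absolute (Neg A).
Proof. intros H. apply absolute_imp; auto using absolute_bot. Qed.

Lemma absolute_ex A : absolute A ->
  (forall e E, pointwise e E (Ex A) -> exists d : cut,
     U (fun n => exists y, y <= cnm d n /\ satN (scons y (eN e n)) (EN E n) A)) ->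
  absolute (Ex A).
Proof.
  intros HA Hb e E. simpl. split.
  - intros [d Hd]. apply HA in Hd. apply (U_mono _ _ Hd). intros n. rewrite scons_eN. simpl. eauto.
  - intros H. destruct (Hb e E H) as [d Hd]. destruct (witness_in_cut A e E d Hd) as [w Hw].
    exists w. now apply HA.
Qed.

Lemma absolute_all A : absolute (Ex (Neg A)) -> absolute (All A).
Proof.
  intros H e E. specialize (H e E). unfold pointwise in *. simpl in *. split.
  - intros K. destruct (U_or (fun n => forall d, satN (scons d (eN e n)) (EN E n) A)) as [L|L]; auto.
    exfalso. assert (N : U (fun n => exists d, satN (scons d (eN e n)) (EN E n) A -> False)).
    { apply (U_mono _ _ L). intros n Hn. apply not_all_ex_not in Hn. exact Hn. }
    apply H in N as [d Hd]. auto.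
  - intros K d. apply NNPP. intros N.
    assert (L : exists d, satM (scons d e) E A -> False) by eauto.
    apply H in L. apply (U_absurd _ L). apply (U_mono _ _ K). intros n Hn [y Hy]. auto.
Qed.

Lemma absolute_bounded_ex t A : absolute A -> absolute (Ex (And (Lt (Var 0) (tlift 1 t)) A)).
Proof.
  intros HA. apply absolute_ex; [apply absolute_and; auto using absolute_lt|].
  intros e E H. exists (evalM e t). apply (U_mono _ _ H). intros n [y [Hy Sy]]. exists y.
  split; [|split; auto]. rewrite cnm_eval. cbn in Hy. rewrite eval_shift in Hy. unfold Nat.lt in Hy. lia.
Qed.

Lemma absolute_bounded_all t A : absolute A -> absolute (AllLt t A).
Proof.
  intros HA. apply absolute_all. apply absolute_ex.
  - apply absolute_neg, absolute_imp; auto using absolute_lt.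
  - intros e E H. exists (evalM e t). apply (U_mono _ _ H). intros n [y Sy]. exists y.
    split; [|exact Sy]. rewrite cnm_eval. apply NNPP. intros N. apply Sy. intros Hy. exfalso.
    cbn in Hy. rewrite eval_shift in Hy. unfold Nat.lt in Hy. lia.
Qed.

Lemma absolute_Delta00 A : Delta00 A -> absolute A.
Proof.
  induction 1; auto using absolute_bot, absolute_eq, absolute_lt, absolute_mem, absolute_imp, absolute_and, absolute_or.
  - now apply absolute_bounded_all.
  - now apply absolute_bounded_ex.
Qed.

(** The cut is closed under [h], which dominates all arithmetical witnesses, so it is an elementary substructure. *)
Lemma absolute_set_free A : set_free A -> absolute A.
Proof.
  assert (K : forall A, set_free A -> absolute A -> absolute (Ex A)).
  { intros B F HB. apply absolute_ex; auto. intros e E H.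
    assert (Bl : exists k, below (S k) B).
    { clear. assert (T : forall t, exists k, forall m, k <= m -> tbelow m t).
      { induction t; simpl; try (exists 0; auto; fail); try (exists (S n); intros; lia);
          (destruct IHt1 as [a Ha], IHt2 as [b Hb]; exists (a + b); intros m Hm; split; [apply Ha|apply Hb]; lia). }
      assert (BB : exists k, forall m, k <= m -> below m B).
      { induction B; simpl; try (exists 0; auto; fail);
          try (destruct (T s) as [a Ha], (T t) as [b Hb]; exists (a + b); intros m Hm; split; [apply Ha|apply Hb]; lia);
          try (destruct IHB1 as [a Ha], IHB2 as [b Hb]; exists (a + b); intros m Hm; split; [apply Ha|apply Hb]; lia);
          try (destruct IHB as [a Ha]; exists a; intros m Hm; apply Ha; lia).
        apply T. }
      destruct BB as [k Hk]. exists k. apply Hk. lia. }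
    destruct Bl as [k Bl]. destruct (h_dom B k F Bl) as [N0 HN0].
    destruct (cut_bound_env e k) as [d Hd]. destruct (cut_h d) as [d' Hd']. exists d'.
    (* Since [d] majorizes n, it passes [N0] almost everywhere; a witness then lies below [h] of
       [d], hence below [d']. *)
    apply (U_3 _ _ _ _ H (U_and _ _ Hd (U_ge N0)) Hd').
    intros n [y Sy] [[H1 H2] H3] H4.
    destruct (HN0 (cnm d n) ltac:(lia) (eN e n) (EN E n) H2 (ex_intro _ y Sy)) as [z [Hz Sz]].
    exists z. split; [lia|exact Sz]. }
  induction A; simpl; intros F; try tauto;
    try (destruct F); auto using absolute_bot, absolute_eq, absolute_lt, absolute_imp, absolute_and, absolute_or.
  apply absolute_all. apply K; [simpl; auto|]. apply absolute_neg; auto.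
Qed.

Lemma absolute_subst A sg rh : absolute A -> absolute (subst sg rh A).
Proof.
  intros H e E. rewrite sat_subst, (H _ _). unfold pointwise.
  assert (Q : forall n, (fun i => cnm (evalM e (sg i)) n) = (fun i => evalN (eN e n) (sg i))).
  { intros n. extensionality i. apply cnm_eval. }
  split; intros K; apply (U_mono _ _ K); intros n; rewrite sat_subst, Q; auto.
Qed.

Lemma MM_arithmetical A : set_free A -> (forall e E, satN e E A) -> forall e E, satM e E A.
Proof. intros F H e E. apply absolute_set_free; auto. apply U_all. intros; apply H. Qed.

Lemma sigma_normal A : Sigma01 A -> exists A', absolute A' /\
  (forall e E d d', d <= d' -> satN (scons d e) E A' -> satN (scons d' e) E A') /\
  (forall e E, satM e E A <-> exists d, satM (scons d e) E A').
Proof.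
  induction 1 as [A H|A H (A' & H1 & H2 & H3)].
  - exists (shift A). split; [|split].
    + apply absolute_subst. now apply absolute_Delta00.
    + intros e E d d' _. rewrite !sat_shift. auto.
    + intros e E. split; [intros K; exists (mc_cut 0); now apply sat_shift|intros [d K]; now apply sat_shift in K].
  (* The inner bound and the new outer bound are the same [d]. [A'] expects it as variable 0, but
     the quantifier puts the witness there, hence the swap. *)
  - exists (Ex (And (Lt (Var 0) (tlift 1 (Var 0))) (nsubst swap A'))). split; [|split].
    + apply absolute_bounded_ex, absolute_subst, H1.
    + intros e E d d' Hd. cbn [sat]. intros [x [Hx K]]. exists x. rewrite sat_swap in *. split; [cbn in *; unfold Nat.lt in *; lia|].
      eapply H2; eauto.
    + intros e E. cbn [sat]. split.
      * intros [x Hx]. apply H3 in Hx as [d Hd].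
        destruct (cut_bound_env (scons x (fun _ => d)) 2) as [u Hu]. destruct (cut_h u) as [u' Hu'].
        assert (Hxu : U (fun n => cnm x n < cnm u' n /\ cnm d n <= cnm u' n)).
        { apply (U_2 _ _ _ Hu Hu'). intros n [_ K] L. pose proof (K 0 ltac:(lia)). pose proof (K 1 ltac:(lia)).
          pose proof (h_sq (cnm u n)). simpl in *. lia. }
        exists u', x. rewrite sat_swap. split.
        { apply (U_mono _ _ Hxu). intros n []; auto. }
        apply H1 in Hd. apply H1. apply (U_2 _ _ _ Hd Hxu). intros n. rewrite !scons_eN.
        intros K [_ L]. exact (H2 _ _ _ _ L K).
      * intros [d [x [_ Hx]]]. exists x. apply H3. exists d. exact (proj1 (sat_swap _ _ _ _ _ _) Hx).
Qed.

Lemma pi_neg_sigma B : Pi01 B -> exists A, Sigma01 A /\ forall e E, satM e E B <-> ~ satM e E A.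
Proof.
  induction 1 as [B H|B H (A & HA & K)].
  - exists (Neg B). split; [apply S_base; repeat constructor; auto|]. intros e E. simpl. tauto.
  - exists (Ex A). split; [now constructor|]. intros e E. simpl. split.
    + intros L [d Hd]. specialize (L d). apply K in L. auto.
    + intros L d. apply K. eauto.
Qed.

(** If A fails at d, ordinary induction in almost every component gives some y below d with A at y
    and not at y + 1. Being bounded by d, such a y is named in the cut and refutes the induction
    step there. *)
Lemma MM_induction A : Delta00 A -> forall e E, satM e E
  (Imp (And (inst Zero A) (All (Imp A (nsubst (scons (Add (Var 0) One) (fun n => Var (S n))) A)))) (All A)).
Proof.
  intros D e E. set (A' := nsubst _ A). pose proof (absolute_Delta00 A D) as HA.
  cbn [sat]. rewrite sat_inst. intros [H0 HS] d. apply NNPP. intros Hd.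
  assert (HB : absolute (And A (Neg A'))) by (apply absolute_and; [|apply absolute_neg, absolute_subst]; auto).
  destruct (witness_in_cut (And A (Neg A')) e E d) as [w Hw].
  - apply HA in H0. rewrite (HA (scons d e) E) in Hd. apply U_not in Hd. unfold pointwise in H0.
    apply (U_2 _ _ _ H0 Hd). intros n K0 Kd. rewrite scons_eN in *.
    replace (cnm (evalM e Zero) n) with 0 in K0 by now rewrite cnm_eval.
    assert (Hn : forall y, satN (scons y (eN e n)) (EN E n) A' <-> satN (scons (S y) (eN e n)) (EN E n) A).
    { intros y. unfold A', nsubst. rewrite sat_subst. apply (sat_congr NS NS_congruent).
      intros [|i]; simpl; lia. }
    apply NNPP. intros N. apply Kd.
    assert (L : forall y, y <= cnm d n -> satN (scons y (eN e n)) (EN E n) A); [|apply L; auto].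
    induction y as [|y IH]; intros Hy; [exact K0|].
    apply NNPP. intros K. apply N. exists y. split; [lia|]. split; [apply IH; lia|]. intros K'. now apply K, Hn.
  - apply HB in Hw. destruct Hw as [Hw1 Hw2]. apply Hw2, HS, Hw1.
Qed.

(** [Z n] holds of [x] when a witness for [A x] appears before any witness for [~ B x];
    inside the cut at most one of the two kinds of witness exists. *)
Lemma MM_comprehension A B : Sigma01 A -> Pi01 B -> forall e E, satM e E
  (Imp (All (Iff A B)) (ExS (All (Iff (Mem (Var 0) 0) (shiftS A))))).
Proof.
  intros HA HB e E HAB.
  destruct (pi_neg_sigma B HB) as (C & HC & HBC).
  destruct (sigma_normal A HA) as (A' & A1 & A2 & A3), (sigma_normal C HC) as (C' & C1 & C2 & C3).
  destruct (comp_code A' C' (fun i => proj1_sig (e i)) E) as [Z HZ].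
  exists Z. intros x.
  assert (K : mem MM x Z <-> satM (scons x e) E A).
  { assert (HABx : satM (scons x e) E A <-> ~ satM (scons x e) E C).
    { rewrite <- HBC. specialize (HAB x). unfold Iff in HAB. cbn [sat] in HAB. tauto. }
    split.
    - intros Hx. apply NNPP. intros N. assert (Hc : satM (scons x e) E C) by (apply NNPP; tauto).
      apply C3 in Hc as [d Hd]. apply N, A3. exists d. apply C1 in Hd. apply A1.
      apply (U_2 _ _ _ Hd Hx). intros n Kc Kz. rewrite !scons_eN in *. apply HZ in Kz as [w [W1 W2]].
      (* The witness [w] may lie outside the cut. As [C'] holds at [d] but not at [w], monotonicity
         gives w < d, and then [A'] holds at [d]. *)
      destruct (le_lt_dec (cnm d n) w) as [L|L].
      + exfalso. apply W2. exact (C2 _ _ _ _ L Kc).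
      + eapply A2; [|exact W1]. lia.
    - intros Ha. assert (Hnc := proj1 HABx Ha). apply A3 in Ha as [d Hd].
      assert (Hd' : ~ satM (scons d (scons x e)) E C') by (intros Q; apply Hnc, C3; eauto).
      apply A1 in Hd. rewrite (C1 _ _) in Hd'. apply U_not in Hd'.
      apply (U_2 _ _ _ Hd Hd'). intros n K1 K2. rewrite !scons_eN in *. apply HZ. eauto. }
  unfold Iff. cbn [sat]. rewrite sat_shiftS. cbn [eval scons]. tauto.
Qed.

Lemma MM_RCA0s A : RCA0s A -> forall e E, satM e E A.
Proof.
  intros H. destruct H; try (apply MM_arithmetical; [cbn; tauto|apply NS_RCA0s; constructor]).
  - now apply MM_induction.
  - now apply MM_comprehension.
Qed.

(** The minima of later stages belong to all earlier stages and are cofinal in the cut. *)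
Lemma stage_unbounded k (x : cut) : exists y : cut, U (fun n => cnm x n < cnm y n) /\ mem MM y (stage k).
Proof.
  destruct (cut_bound x) as [j Hj]. exists (mc_cut (S (j + k))). split.
  - apply (U_3 _ _ _ _ Hj (mc_mono j (j + k) ltac:(lia)) (mc_succ (j + k))).
    intros n H1 H2 H3. pose proof (h_sq (nm (mc (j + k)) n)).
    change (cnm (mc_cut (S (j + k))) n) with (nm (mc (S (j + k))) n). lia.
  - apply (U_2 _ _ _ (mc_least (S (j + k))) (stage_sub k (S (j + k)) ltac:(lia))). intros n [H _] K. now apply K.
Qed.

Lemma cut_lt_bnd (x : cut) : U (fun n => cnm x n < bnd n).
Proof.
  destruct (cut_bound x) as [k Hk]. apply (U_3 _ _ _ _ Hk (mc_least k) (stage_bnd k)).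
  intros n H1 [H2 _] H3. specialize (H3 _ H2). lia.
Qed.

(** A longest string all of whose restrictions lie in the tree is longer than every element of the cut. *)
Lemma MM_WKL e E : satM e E WKL.
Proof.
  unfold WKL, BinTree, Unbounded. cbn [sat]. intros T [[HB1 HB2] HU].
  assert (Good : forall t : cut, mem MM t T -> U (fun n => good_string (st T n) (cnm t n))).
  { intros t Ht.
    (* Closure of [T] under initial segments is known on the cut only. Restrictions of t are at most
       t, so a bounded formula expresses what is needed, and absoluteness carries it to almost every
       component. *)
    set (phi := AllLt (Add (Var 0) One) (Imp (Init (Var 0) (Var 1)) (Mem (Var 0) 0))).
    assert (Aphi : absolute phi).
    { apply absolute_bounded_all, absolute_imp; [apply absolute_set_free; cbn; tauto|apply absolute_mem]. }
    assert (Hphi : satM (scons t e) (scons T E) phi).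
    { intros u _ Hu. apply (HB2 u t). split; [exact Ht|].
      change (Init (Var 1) (Var 0)) with (nsubst swap (Init (Var 0) (Var 1))). apply sat_swap, Hu. }
    apply Aphi in Hphi. destruct (HB1 t Ht) as [l Hl].
    apply absolute_set_free in Hl; [|cbn; tauto].
    apply (U_2 _ _ _ Hphi Hl). intros n K L. apply sat_Len in L. cbn [eval scons] in L.
    pose proof (pow2_pos (cnm l n)). split; [lia|]. intros m Hm.
    rewrite scons_eN in K.
    assert (R : restrict (cnm t n) m <= cnm t n).
    { unfold restrict. pose proof (pow2_pos m). pose proof (Nat.div_mod (cnm t n) (2 ^ m) ltac:(lia)).
      pose proof (Nat.div_str_pos (cnm t n) (2 ^ m) ltac:(lia)). nia. }
    apply (K (restrict (cnm t n) m)).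
    - cbn. unfold Nat.lt. lia.
    - apply (sat_Init_restrict _ _ _ _ m); auto. }
  set (P := Op OPath Nil (Cons T Nil)). exists P. intros x.
  (* The exponent x + 1 makes the string of length x taken from the path smaller than 2^(x+1) < t,
     so it lies in the cut; it also makes t long enough. *)
  assert (Hexp := MM_RCA0s _ R_exp (fun _ => add MM x (one MM)) E (add MM x (one MM))).
  destruct Hexp as [p Hp]. apply absolute_set_free in Hp; [|cbn; tauto].
  destruct (HU p) as [t [Hpt Ht]].
  set (body := And (Mem (Var 0) 1) (And (Len (Var 0) (Var 1)) (AllLt (Var 1) (Iff (Bit (Var 1) (Var 0)) (Mem (Var 0) 0))))).
  assert (Abody : absolute body).
  { apply absolute_and; [apply absolute_mem|]. apply absolute_and; [apply absolute_set_free; cbn; tauto|].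
    apply absolute_bounded_all. apply absolute_and; apply absolute_imp; try apply absolute_mem;
      apply absolute_set_free; cbn; tauto. }
  destruct (witness_in_cut body (scons x e) (scons P (scons T E)) t) as [w Hw]; [|exists w; now apply Abody].
  apply (U_3 _ _ _ _ (U_and _ _ Hp Hpt) (Good t Ht) (cut_lt_bnd t)). intros n [K1 K2] K3 K4.
  apply sat_Pow2 in K1. cbn [eval scons] in K1, K2.
  change (cnm (add MM x (one MM)) n) with (nm (add_code (proj1_sig x) one_code) n) in K1.
  rewrite nm_add, nm_one, Nat.add_1_r, Nat.pow_succ_r' in K1. fold (cnm x n) in K1. change (cnm p n < cnm t n) in K2.
  destruct (longest_string_spec _ _ _ K3 K4) as [L1 L2].
  set (s := longest_string (st T n) (bnd n)) in *.
  assert (L3 : 2 ^ cnm x n <= s).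
  { assert (cnm x n <= Nat.log2 (cnm t n)).
    { rewrite <- (Nat.log2_pow2 (cnm x n)) by lia. apply Nat.log2_le_mono. lia. }
    destruct L1 as [L1 _]. destruct (Nat.log2_spec s L1) as [L4 _].
    apply (Nat.le_trans _ (2 ^ Nat.log2 s)); auto. apply Nat.pow_le_mono_r; lia. }
  pose proof (restrict_bounds s (cnm x n)) as RB.
  exists (restrict s (cnm x n)). split; [lia|].
  unfold body. cbn [sat]. split; [apply L1, L3|]. split; [apply sat_Len; exact RB|].
  intros i Hi. cbn in Hi. unfold Iff. cbn [sat]. rewrite !sat_Bit. cbn [eval scons].
  rewrite (testbit_restrict s (cnm x n) i Hi).
  change (mem NS i (st P n)) with (Nat.testbit s i = true). tauto.
Qed.

(** * Chains, antichains and monotone sequences *)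

Definition related (R : code) (x y : cut) : Prop := U (fun n => st R n (npair (cnm x n) (cnm y n)) = true).

Lemma mem_pair e s t X : mem MM (evalM e (pair s t)) X <-> related X (evalM e s) (evalM e t).
Proof.
  unfold related, pair. cbn [mem MM].
  split; intros H; apply (U_mono _ _ H); intros n; rewrite !cnm_eval; auto.
Qed.

Lemma cut_trichotomy (x y : cut) : U (fun n => cnm x n < cnm y n) \/ U (fun n => cnm x n = cnm y n) \/ U (fun n => cnm y n < cnm x n).
Proof. rewrite <- !U_disj. apply U_all. intros; lia. Qed.

(** Transitivity restricted to numbers up to y is a bounded statement, hence absolute. This removes
    the cut-off in [rel_up] and [rel_down] at every element of the cut. *)
Lemma trans_pointwise R : (forall x y z, related R x y -> related R y z -> related R x z) ->
  forall y : cut, U (fun n => trans_upto (st R n) (cnm y n)).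
Proof.
  intros HT y.
  set (phi := AllLt (Add (Var 0) One) (AllLt (Add (Var 1) One) (AllLt (Add (Var 2) One)
    (Imp (And (Mem (pair (Var 2) (Var 1)) 0) (Mem (pair (Var 1) (Var 0)) 0)) (Mem (pair (Var 2) (Var 0)) 0))))).
  assert (Aphi : absolute phi).
  { do 3 apply absolute_bounded_all. apply absolute_imp; [apply absolute_and|]; apply absolute_mem. }
  assert (H : satM (fun _ => y) (fun _ => R) phi).
  { intros a _ b _ c _ [H1 H2]. apply mem_pair in H1, H2. apply mem_pair. apply (HT _ _ _ H1 H2). }
  apply Aphi in H. apply (U_mono _ _ H). intros n K a b c Ha Hb Hc H1 H2.
  apply (K a ltac:(cbn; unfold Nat.lt; lia) b ltac:(cbn; unfold Nat.lt; lia) c ltac:(cbn; unfold Nat.lt; lia)).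
  split; [exact H1|exact H2].
Qed.

Lemma stage_homogeneous k : (forall y : cut, U (fun n => trans_upto (st (en k) n) (cnm y n))) ->
  let H := stage (S k) in
  ((forall x y, mem MM x H -> mem MM y H -> lt MM x y -> related (en k) x y) \/
   (forall x y, mem MM x H -> mem MM y H -> lt MM x y -> ~ related (en k) x y)) /\
  ((forall x y, mem MM x H -> mem MM y H -> lt MM x y -> related (en k) y x) \/
   (forall x y, mem MM x H -> mem MM y H -> lt MM x y -> ~ related (en k) y x)).
Proof.
  intros HT H. pose proof (stage_step k) as HS. split.
  - assert (K : U (fun n => homogeneous (st H n) (rel_up (st (en k) n)) \/
                            homogeneous (st H n) (fun x y => ~ rel_up (st (en k) n) x y))).
    { apply (U_mono _ _ HS). intros n S. exact (step_up _ _ _ _ _ S). }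
    apply U_disj in K as [K|K]; [left|right]; intros x y Hx Hy Hxy.
    + apply (U_2 _ _ _ K (U_and _ _ Hx (U_and _ _ Hy Hxy))). intros n L [? [? ?]]. now apply L.
    + intros N. apply U_ne. apply (U_3 _ _ _ _ K (U_and _ _ Hx (U_and _ _ Hy Hxy)) (U_and _ _ N (HT y))).
      intros n L [? [? ?]] [? ?]. apply (L (cnm x n) (cnm y n)); auto. now split.
  - assert (K : U (fun n => homogeneous (st H n) (rel_down (st (en k) n)) \/
                            homogeneous (st H n) (fun x y => ~ rel_down (st (en k) n) x y))).
    { apply (U_mono _ _ HS). intros n S. exact (step_down _ _ _ _ _ S). }
    apply U_disj in K as [K|K]; [left|right]; intros x y Hx Hy Hxy.
    + apply (U_2 _ _ _ K (U_and _ _ Hx (U_and _ _ Hy Hxy))). intros n L [? [? ?]]. now apply L.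
    + intros N. apply U_ne. apply (U_3 _ _ _ _ K (U_and _ _ Hx (U_and _ _ Hy Hxy)) (U_and _ _ N (HT y))).
      intros n L [? [? ?]] [? ?]. apply (L (cnm x n) (cnm y n)); auto. now split.
Qed.

Lemma related_eqv R x y y' : eqv MM y y' -> related R x y -> related R x y'.
Proof. intros H1 H2. apply (U_2 _ _ _ H1 H2). intros n ->. auto. Qed.

Lemma partial_orderE e E X : satM e E (Partial_order X) ->
  (forall x, related (E X) x x) /\
  (forall x y, related (E X) x y -> related (E X) y x -> eqv MM x y) /\
  (forall x y z, related (E X) x y -> related (E X) y z -> related (E X) x z).
Proof.
  unfold Partial_order. cbn [sat]. intros [H1 [H2 H3]]. split; [|split].
  - intros x. specialize (H1 x). now apply mem_pair in H1.
  - intros x y Hx Hy. apply (H2 y x). split; apply mem_pair; [exact Hx|exact Hy].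
  - intros x y z Hx Hy. specialize (H3 z y x). rewrite !mem_pair in H3. apply H3. split; [exact Hx|exact Hy].
Qed.

Lemma stage_sat_unbounded k e E : satM e (scons (stage k) E) (Unbounded 0).
Proof. intros x. destruct (stage_unbounded k x) as [y [H1 H2]]. exists y. split; [exact H1|exact H2]. Qed.

(** Stage [S k] is homogeneous in both directions: a positive outcome in either makes it a chain,
    two negative outcomes make it an antichain. *)
Lemma MM_CAC e E : satM e E CAC.
Proof.
  unfold CAC. cbn [sat]. intros R HR. apply partial_orderE in HR as [Hrefl [_ Htrans]]. cbn [scons] in *.
  destruct (en_surj R) as [k <-].
  destruct (stage_homogeneous k (trans_pointwise _ Htrans)) as [HA HB].
  exists (stage (S k)). split; [apply stage_sat_unbounded|].
  assert (Heq : forall x y, eqv MM x y -> related (en k) x y) by (intros x y H; apply (related_eqv _ _ _ _ H), Hrefl).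
  assert (Hsym : forall x y, eqv MM x y -> eqv MM y x) by apply (eqv_sym _ MM_congruent).
  destruct HA as [HA|HA]; [left|destruct HB as [HB|HB]; [left|right]].
  - intros x y [Hy Hx]. cbn [sat]. rewrite !mem_pair. change (related (en k) y x \/ related (en k) x y).
    destruct (cut_trichotomy x y) as [L|[L|L]].
    + right. apply HA; auto.
    + right. apply Heq; auto.
    + left. apply HA; auto.
  - intros x y [Hy Hx]. cbn [sat]. rewrite !mem_pair. change (related (en k) y x \/ related (en k) x y).
    destruct (cut_trichotomy x y) as [L|[L|L]].
    + left. apply HB; auto.
    + right. apply Heq; auto.
    + right. apply HB; auto.
  - intros x y [Hy [Hx Hne]]. cbn [sat Neg]. rewrite !mem_pair.
    change (~ (related (en k) y x \/ related (en k) x y)). change (~ eqv MM y x) in Hne.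
    destruct (cut_trichotomy x y) as [L|[L|L]].
    + intros [K|K]; [exact (HB x y Hx Hy L K)|exact (HA x y Hx Hy L K)].
    + destruct Hne. auto.
    + intros [K|K]; [exact (HA y x Hy Hx L K)|exact (HB y x Hy Hx L K)].
Qed.

(** The upward direction decides: if it is negative, totality reverses every pair, and the stage is
    descending. *)
Lemma MM_ADS e E : satM e E ADS.
Proof.
  unfold ADS. cbn [sat]. intros R [HR HL]. apply partial_orderE in HR as [Hrefl [Hanti Htrans]]. cbn [scons] in *.
  assert (Htot : forall x y, related R x y \/ related R y x).
  { intros x y. specialize (HL y x). cbn [sat] in HL. rewrite !mem_pair in HL. exact HL. }
  destruct (en_surj R) as [k <-].
  destruct (stage_homogeneous k (trans_pointwise _ Htrans)) as [HA _].
  exists (stage (S k)). split; [apply stage_sat_unbounded|].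
  assert (Heq : forall x y, eqv MM x y -> related (en k) x y) by (intros x y H; apply (related_eqv _ _ _ _ H), Hrefl).
  assert (Hsym : forall x y, eqv MM x y -> eqv MM y x) by apply (eqv_sym _ MM_congruent).
  destruct HA as [HA|HA]; [left|right].
  - intros x y [Hy Hx]. unfold Iff, Le. cbn [sat]. rewrite !mem_pair.
    change (((lt MM y x \/ eqv MM y x) -> related (en k) y x) /\ (related (en k) y x -> lt MM y x \/ eqv MM y x)).
    split.
    + intros [L|L]; auto.
    + intros K. destruct (cut_trichotomy x y) as [L|[L|L]]; auto.
  - intros x y [Hy Hx]. unfold Iff, Le. cbn [sat]. rewrite !mem_pair.
    change (((lt MM y x \/ eqv MM y x) -> related (en k) x y) /\ (related (en k) x y -> lt MM y x \/ eqv MM y x)).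
    split.
    + intros [L|L]; [|auto]. destruct (Htot x y) as [K|K]; auto. destruct (HA y x Hy Hx L K).
    + intros K. destruct (cut_trichotomy x y) as [L|[L|L]]; auto. destruct (HA x y Hx Hy L K).
Qed.

(** * The diagonal number is in the definable cut, its image under G is not *)

Lemma unique_witness A e E (d : cut) : absolute A ->
  U (fun n => exists y, y <= cnm d n /\ satN (scons y (eN e n)) (EN E n) A) ->
  (forall x y, satM (scons x e) E A -> satM (scons y e) E A -> eqv MM y x) ->
  satM e E (Ex1 A).
Proof.
  intros HA Hex Hun. destruct (witness_in_cut A e E d Hex) as [w Hw]. apply HA in Hw.
  apply sat_Ex1. exists w. auto.
Qed.

(** Once n elements of [p] are known to lie below the minimum of a stage, the first n elements of
    [p] form a subset bounded in the cut, and their increasing enumeration is a named bijection. *)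
Lemma id_in_I01 e E : satM (scons id_cut e) E (I01 (Var 0)).
Proof.
  unfold I01. cbn [sat]. intros p Hp. destruct (en_surj p) as [k Hk].
  pose proof (stage_step k) as HS. rewrite Hk in HS.
  assert (HF : U (fun n => n <= card (nm (mc (S k)) n) (st p n))).
  { assert (HG : U (fun n => (forall x y z, st (stage (S k)) n x = true -> st (stage (S k)) n y = true -> x <= z < y -> st p n z = false) \/
             (forall x, st (stage (S k)) n x = true -> n <= card x (st p n)))).
    { apply (U_mono _ _ HS). intros n S. exact (step_gap _ _ _ _ _ S). }
    apply U_disj in HG as [HG|HG].
    (* An unbounded [p] has an element [q] above the minimum of the stage, and the stage has an
       element above [q]; so [p] cannot avoid the convex hull. *)
    - exfalso. destruct (Hp (mc_cut (S k))) as [q [Hq1 Hq2]].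
      destruct (stage_unbounded (S k) q) as [y [Hy1 Hy2]].
      apply U_ne. apply (U_3 _ _ _ _ HG (U_and _ _ Hq1 Hq2) (U_and _ _ (mc_least (S k)) (U_and _ _ Hy1 Hy2))).
      intros n K [Q1 Q2] [[M1 _] [Y1 Y2]]. change (nm (mc (S k)) n < cnm q n) in Q1. change (st p n (cnm q n) = true) in Q2.
      rewrite (K _ _ (cnm q n) M1 Y2) in Q2; [discriminate|].
      split; [apply Nat.lt_le_incl, Q1|exact Y1].
    - apply (U_2 _ _ _ HG (mc_least (S k))). intros n K [M1 _]. now apply K. }
  set (Z := Op OFirst Nil (Cons p Nil)). set (gr := Op OGraph Nil (Cons p Nil)).
  assert (HZ : forall n x, st Z n x = true <-> st p n x = true /\ card x (st p n) < n).
  { intros n x. apply pboolP. }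
  assert (Hgr : forall n i x, st gr n (npair i x) = true <-> st p n x = true /\ i = card x (st p n) /\ i < n).
  { intros n i x. apply enumeration_true. }
  exists Z. split; [|split].
  - intros x Hx. apply (U_mono _ _ Hx). intros n K. now apply HZ in K.
  - exists (mc_cut (S k)). intros x Hx. apply (U_2 _ _ _ Hx HF). intros n K L. apply HZ in K as [_ K].
    change (cnm x n < nm (mc (S k)) n).
    destruct (le_lt_dec (nm (mc (S k)) n) (cnm x n)) as [L'|]; auto.
    pose proof (card_mono _ _ (st p n) L'). change (card (cnm x n) (st p n) < n) in K. lia.
  - exists gr. split; [|split].
    + intros i v Hiv. apply mem_pair in Hiv. split; apply (U_mono _ _ Hiv); intros n K; apply Hgr in K as [K1 [K2 K3]].
      * exact K3.
      * apply HZ. split; [exact K1|]. now rewrite <- K2.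
    + intros i Hi. apply (unique_witness _ _ _ (mc_cut (S k))); [apply absolute_mem| |].
      * apply (U_2 _ _ _ Hi HF). intros n K1 K2. change (cnm i n < n) in K1.
        destruct (card_nth _ _ (cnm i n) (Nat.lt_le_trans _ _ _ K1 K2)) as [x [X1 [X2 X3]]].
        exists x. split; [apply Nat.lt_le_incl, X1|]. apply Hgr. auto.
      * intros x y Hx Hy. apply mem_pair in Hx, Hy. apply (U_2 _ _ _ Hx Hy). intros n Kx Ky.
        apply Hgr in Kx as [X1 [X2 X3]], Ky as [Y1 [Y2 Y3]]. exact (card_inj (st p n) _ _ Y1 X1 (eq_trans (eq_sym Y2) X2)).
    + intros v Hv. apply (unique_witness _ _ _ id_cut); [apply absolute_mem| |].
      * apply (U_mono _ _ Hv). intros n K. apply HZ in K as [K1 K2].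
        exists (card (cnm v n) (st p n)). split; [apply Nat.lt_le_incl, K2|]. apply Hgr. auto.
      * intros x y Hx Hy. apply mem_pair in Hx, Hy. apply (U_2 _ _ _ Hx Hy). intros n Kx Ky.
        apply Hgr in Kx as [X1 [X2 X3]], Ky as [Y1 [Y2 Y3]]. etransitivity; [exact Y2|symmetry; exact X2].
Qed.

Lemma Ex1_exists e E A : satM e E (Ex1 A) -> exists w, satM (scons w e) E A.
Proof. intros H. apply sat_Ex1 in H as [w [Hw _]]. eauto. Qed.

Lemma Ex1_unique e E A x y : satM e E (Ex1 A) -> satM (scons x e) E A -> satM (scons y e) E A -> eqv MM x y.
Proof.
  intros H Hx Hy. apply sat_Ex1 in H as [w [_ Hw]].
  apply (eqv_trans _ MM_congruent _ w); auto. apply (eqv_sym _ MM_congruent); auto.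
Qed.

(** The unbounded set [stage 0] has only [G n] elements, and its part below an element of the cut has fewer. *)
Lemma G_not_in_I01 e E (y : cut) : U (fun n => cnm y n = G n) -> ~ satM (scons y e) E (I01 (Var 0)).
Proof.
  intros Hy HI. specialize (HI (stage 0) (stage_sat_unbounded 0 _ _)).
  change (satM (scons y e) (scons (stage 0) E) (ExS (And (Subset 0 1) (And (Finite 0) (Card 0 (Var 0)))))) in HI.
  unfold Subset, Finite, Card, AllLt in HI. cbn [sat] in HI.
  destruct HI as [Z [Hsub [[b Hb] [gr [H1 [H2 H3]]]]]].
  assert (H1' : forall i v, related gr i v -> lt MM i y /\ mem MM v Z).
  { intros i v Hiv. apply (H1 i v). apply mem_pair. exact Hiv. }
  (* Bounding the values by [b] makes totality ([phi]) and injectivity ([psi]) of the bijection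
     bounded formulas, which can be read in a component. *)
  set (phi := AllLt (Var 0) (Ex (And (Lt (Var 0) (tlift 1 (Var 2)))
                (And (Mem (pair (Var 1) (Var 0)) 0) (Mem (Var 0) 1))))).
  set (psi := AllLt (Var 0) (AllLt (Var 1) (AllLt (Var 3)
                (Imp (And (Mem (pair (Var 2) (Var 0)) 0) (Mem (pair (Var 1) (Var 0)) 0)) (Eq (Var 2) (Var 1)))))).
  set (ee := scons y (fun _ => b)). set (EE := scons gr (fun _ => stage 0)).
  assert (Hphi : pointwise ee EE phi).
  { assert (Aphi : absolute phi).
    { apply absolute_bounded_all, absolute_bounded_ex, absolute_and; apply absolute_mem. }
    apply Aphi. intros i Hi. destruct (Ex1_exists _ _ _ (H2 i Hi)) as [v Hv].
    exists v. apply mem_pair in Hv. destruct (H1' i v Hv) as [_ Hz].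
    split; [exact (Hb v Hz)|]. split; [apply mem_pair; exact Hv|exact (Hsub v Hz)]. }
  assert (Hpsi : pointwise ee EE psi).
  { assert (Apsi : absolute psi).
    { do 3 apply absolute_bounded_all. apply absolute_imp; [apply absolute_and; apply absolute_mem|apply absolute_eq]. }
    apply Apsi. intros i Hi j Hj v Hv [Kx Ky]. apply mem_pair in Kx, Ky.
    destruct (H1' i v Kx) as [_ Hz].
    apply (Ex1_unique _ _ _ i j (H3 v Hz)); apply mem_pair; assumption. }
  destruct (cut_bound b) as [j Hj].
  (* All these facts hold together at some actual n. There [b] is at most the iterate of [h] with
     index j0 < G n, so the G n arguments would inject into the indices below j0. *)
  destruct (U_ex _ (U_and _ _ (U_and _ _ Hphi Hpsi) (U_and _ _ Hy
    (U_and _ _ Hj (U_and _ _ (mc_least j) (stage_sub 0 j (Nat.le_0_l _))))))) as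
    [n [[K1 K2] [K3 [K4 [[K5 _] K6]]]]].
  apply K6, stage_0 in K5 as [j0 [J1 J2]].
  assert (Hle : G n <= card j0 (fun _ => true)).
  { apply (injection_card (fun i j' => exists v, v < cnm b n /\ st gr n (npair i v) = true /\ v = Nat.iter j' h n)).
    - intros i Hi. rewrite <- K3 in Hi. destruct (K1 i Hi) as [v [V1 [V2 V3]]].
      change (v < cnm b n) in V1. change (st gr n (npair i v) = true) in V2. apply stage_0 in V3 as [j' [_ V3]].
      exists j'. split; [|split; [reflexivity|exists v; auto]].
      destruct (le_lt_dec j0 j') as [L|L]; auto. pose proof (iter_h_mono _ _ n L). change (v = Nat.iter j' h n) in V3. lia.
    - intros i i' j' Hi Hi' [v [V1 [V2 V3]]] [v' [V1' [V2' V3']]]. rewrite <- K3 in Hi, Hi'.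
      assert (Q : v' = v) by congruence. rewrite Q in V2'. apply (K2 i Hi i' Hi' v V1). split; [exact V2|exact V2']. }
  rewrite card_true in Hle. lia.
Qed.

(** Since [g] is set-free it is absolute, so the value it assigns in the cut to the diagonal number
    equals G n almost everywhere. *)
Lemma MM_not_closed g : set_free g -> (forall e E n y, satN (scons n (scons y e)) E g -> y = G n) ->
  forall e E, ~ satM e E (I01_closed_under g).
Proof.
  intros F HG e E H.
  destruct (H id_cut (id_in_I01 e E)) as [y [Hy HI]].
  apply (G_not_in_I01 (scons id_cut e) E y); [|exact HI].
  unfold nsubst in Hy. apply sat_subst in Hy.
  apply absolute_set_free in Hy; auto. apply (U_mono _ _ Hy). intros n K.
  apply (HG (fun i => cnm (scons y (scons id_cut e) i) n) (EN E n)).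
  eapply (sat_congr NS NS_congruent); [|exact K]. intros [|[|i]]; reflexivity.
Qed.

Lemma MM_unprovable g P : set_free g -> (forall e E n y, satN (scons n (scons y e)) E g -> y = G n) ->
  (forall e E, satM e E P) -> ~ proves (extend WKL0s P) (I01_closed_under g).
Proof.
  intros F HG HP D. apply (MM_not_closed g F HG (fun _ => id_cut) (fun _ => Nil)).
  apply (soundness MM MM_congruent _ _ _ D); [|contradiction].
  intros B [[H| ->]| ->] e E; auto using MM_RCA0s, MM_WKL.
Qed.

End Cut.

(** * From provability to the standard function *)

Lemma evalN_numeral e n : evalN e (numeral n) = n.
Proof. induction n; simpl; auto. rewrite IHn. lia. Qed.

Lemma evalN_tpow e t k : evalN e (tpow t k) = evalN e t ^ k.
Proof. induction k; simpl; auto. rewrite IHk. lia. Qed.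

Lemma NS_sound A : proves RCA0s A -> satN (fun _ => 0) no_sets A.
Proof. intros H. apply (soundness NS NS_congruent _ _ _ H); [exact NS_RCA0s|contradiction]. Qed.

(** Provable totality and uniqueness are true in the standard model, which makes the relation
    defined by [g] the graph of a function; locality frees it from the ambient assignment. *)
Lemma standard_function g : Sigma1_function g ->
  exists G, forall e E x y, satN (scons x (scons y e)) E g <-> y = G x.
Proof.
  intros [[_ F] [Bl Htot]]. apply NS_sound in Htot.
  assert (L : forall e E e' E' x y, satN (scons x (scons y e)) E g -> satN (scons x (scons y e')) E' g).
  { intros e E e' E' x y. apply (sat_local NS g 2 Bl F). intros [|[|i]] Hi; auto; lia. }
  assert (H : forall x, exists y, forall z, satN (scons x (scons z (fun _ => 0))) no_sets g <-> z = y).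
  { intros x. specialize (Htot x). apply sat_Ex1 in Htot as [y [Hy Hu]]. exists y.
    assert (K : forall z, satN (scons z (scons x (fun _ => 0))) no_sets (nsubst (scons (Var 1) (scons (Var 0) Var)) g) <->
       satN (scons x (scons z (fun _ => 0))) no_sets g).
    { intros z. unfold nsubst. rewrite sat_subst. apply (sat_local NS g 2 Bl F). intros [|[|i]] Hi; auto; lia. }
    intros z. rewrite <- K. split; [apply Hu|intros ->; exact Hy]. }
  destruct (choice _ H) as [G HG]. exists G. intros e E x y. rewrite <- HG. split; apply L.
Qed.

Theorem theorem3p16 (g : form) (hg : Sigma1_function g)
    (hgrow : forall k : nat, exists n : nat, proves RCA0s (grows g n k)) :
  ~ proves (extend WKL0s CAC) (I01_closed_under g) /\
  ~ proves (extend WKL0s ADS) (I01_closed_under g).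
Proof.
  destruct (standard_function g hg) as [G HG]. destruct hg as [[_ F] _].
  destruct ultrafilter_nat as (U & U1 & U2 & U3 & U4 & U5).
  destruct dominating_function as (h & h1 & h2 & h3).
  destruct code_countable as [en Hen].
  assert (Ggrow : forall k, exists N, forall n, N <= n -> n ^ k <= G n).
  { intros k. destruct (hgrow k) as [N HN]. exists N. intros n Hn. apply NS_sound in HN.
    destruct (HN n) as [y [Hy Hle]].
    - simpl. rewrite evalN_numeral. destruct (le_lt_eq_dec N n Hn); [left|right]; auto.
    - unfold nsubst in Hy. apply sat_subst in Hy.
      assert (y = G n) as <-.
      { apply (HG (scons y (scons n (fun _ => 0))) no_sets). eapply (sat_congr NS NS_congruent); [|exact Hy].
        intros [|[|i]]; reflexivity. }
      simpl in Hle. rewrite evalN_tpow in Hle. simpl in Hle. unfold Nat.lt in Hle. lia. }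
  assert (HG' : forall e E n y, satN (scons n (scons y e)) E g -> y = G n) by (intros e E n y; apply HG).
  split.
  - apply (MM_unprovable U U1 U2 U3 U4 U5 G h Ggrow h1 h2 h3 en Hen g CAC F HG').
    intros e E. apply MM_CAC; assumption.
  - apply (MM_unprovable U U1 U2 U3 U4 U5 G h Ggrow h1 h2 h3 en Hen g ADS F HG').
    intros e E. apply MM_ADS; assumption.
Qed.
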